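(* Let $a$ be a weak composition of length $n$. Then $$\hat\kappa_a = \sum_{f(c) \sim \mathrm{col}(\mathrm{key}(a)), \, w \textrm{ is $c$-compatible}} x^{\mathrm{comp}(f(w))}.$$
   Context: The Young key polynomial is $\hat\kappa_a(x_1,\ldots,x_n)=\kappa_{\mathrm{rev}(a)}(x_n,\ldots,x_1)$, where $\kappa_b=\pi_{w_b}x^{\mathrm{sort}(b)}$ is the key polynomial (Demazure character), with $\pi_i f=\partial_i(x_if)$, $\partial_i f=(f-s_if)/(x_i-x_{i+1})$, $w_b$ the minimal length permutation sending $b$ to its decreasing rearrangement $\mathrm{sort}(b)$, and $\mathrm{rev}(a)$ the reversal of $a$. $\mathrm{key}(a)$ is the unique key (a semistandard Young tableau in which each column's entry set contains the next column's entry set) of weight $a$, and $\mathrm{col}(T)$ is the column reading word of $T$ (reading entries down each column, columns from left to right). $\sim$ denotes Knuth equivalence of words. For a word $w$ in $\{1,\ldots,n\}$, the flip $f(w)$ replaces each letter $w_i$ by $n+1-w_i$. Given a word $c=c_1\cdots c_p$, a word $w=w_1\cdots w_p$ is $c$-compatible if $1\le w_1\le\cdots\le w_p\le n$, $w_k<w_{k+1}$ whenever $c_k<c_{k+1}$, and $w_k\le c_k$ for all $k$. $\mathrm{comp}(w)$ is the weak composition whose $i$th entry counts occurrences of $i$ in $w$. *)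

(* Defs.v *)
From HB Require Import structures.
From mathcomp Require Import all_boot all_order all_fingroup all_algebra.
From mathcomp Require Import mpoly.

Set Implicit Arguments.
Unset Strict Implicit.
Unset Printing Implicit Defensive.

Import GRing.Theory.

(* Positions, variables and letters 1, ..., n are the elements 0, ..., n-1 of   *)
(* 'I_n.  A weak composition of length n is an n.-tuple nat.                    *)

Definition rev_comp n (b : n.-tuple nat) : n.-tuple nat := [tuple of rev b].

Definition sort_comp n (b : n.-tuple nat) : n.-tuple nat :=
  [tuple of sort geq b].

Definition xpow n (b : n.-tuple nat) : {mpoly int[n]} := 'X_[Multinom b].

Section SimpleTranspositions.
Variable n : nat.
Implicit Types (i : 'I_n.-1) (w : 'S_n) (s : seq 'I_n.-1).

Fact next_subproof i : i.+1 < n. Proof. by rewrite -ltn_predRL. Qed.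

Definition this_pos i : 'I_n := widen_ord (leq_pred n) i.
Definition next_pos i : 'I_n := Ordinal (next_subproof i).

Definition simple_tr i : 'S_n := tperm (this_pos i) (next_pos i).

(* s_{i_1} o s_{i_2} o ... o s_{i_r} as a composite of functions; the product   *)
(* of permutations in MathComp is (u * v)%g x = v (u x), hence the order.      *)
Definition perm_of_word s : 'S_n := foldr (fun i w => w * simple_tr i)%g 1%g s.

Lemma perm_of_word_cat s t :
  perm_of_word (s ++ t) = (perm_of_word t * perm_of_word s)%g.
Proof. by elim: s => [|i s IHs] /=; rewrite ?mulg1 // IHs mulgA. Qed.

Lemma tperm_word d (x y : 'I_n) :
  y = (x + d)%N :> nat -> exists s, perm_of_word s = tperm x y.
Proof.
elim: d y => [|d IHd] y ydef.
  have -> : y = x by apply: val_inj; rewrite /= ydef addn0.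
  by exists [::]; rewrite tperm1.
have lt_i : x + d < n.-1 by rewrite ltn_predRL -addnS -ydef.
pose i : 'I_n.-1 := Ordinal lt_i.
have [s sE] := IHd (this_pos i) erefl.
have yE : y = next_pos i by apply: val_inj; rewrite /= ydef addnS.
have [d0|d_gt0] := posnP d.
  have -> : x = this_pos i by apply: val_inj; rewrite /= d0 addn0.
  by exists [:: i]; rewrite yE /= mul1g.
exists (i :: s ++ [:: i]).
rewrite /= perm_of_word_cat sE /= mul1g.
have x1 : this_pos i != x.
  by rewrite -val_eqE /= -[X in _ != X]addn0 eqn_add2l -lt0n.
have x2 : next_pos i != x.
  by rewrite -val_eqE /= -addnS -[X in _ != X]addn0 eqn_add2l.
have := tpermJ x (this_pos i) (simple_tr i).
rewrite /conjg tpermV mulgA => ->.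
by rewrite /simple_tr (tpermD x1 x2) tpermL yE.
Qed.

Lemma perm_of_word_surj w : exists s, perm_of_word s = w.
Proof.
have [ts -> _] := prod_tpermP w.
elim: ts => [|[x y] ts [s sE]]; first by exists [::]; rewrite big_nil.
have [t tE] : exists t, perm_of_word t = tperm x y.
  case: (leqP x y) => [le_xy|/ltnW le_yx].
    by apply: (@tperm_word (y - x)); rewrite subnKC.
  by rewrite tpermC; apply: (@tperm_word (x - y)); rewrite subnKC.
by exists (s ++ t); rewrite perm_of_word_cat big_cons sE tE.
Qed.

Fact perm_length_subproof w :
  exists r, [exists s : r.-tuple 'I_n.-1, perm_of_word s == w].
Proof.
have [s <-] := perm_of_word_surj w.
by exists (size s); apply/existsP; exists (in_tuple s).
Qed.

Definition perm_length w : nat := ex_minn (perm_length_subproof w).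

Fact reduced_word_subproof w :
  exists s, (perm_of_word s == w) && (size s == perm_length w).
Proof.
rewrite /perm_length; case: ex_minnP => r /existsP[s sE] _.
by exists s; rewrite sE size_tuple eqxx.
Qed.

Definition reduced_word w : seq 'I_n.-1 := xchoose (reduced_word_subproof w).

End SimpleTranspositions.

Section KeyPolynomials.
Local Open Scope ring_scope.
Variable n : nat.
Implicit Types (f g : {mpoly int[n]}) (i : 'I_n.-1) (b : n.-tuple nat).

Fact ddiff_subproof i f :
  exists g, g * ('X_(this_pos i) - 'X_(next_pos i)) == f - msym (simple_tr i) f
  :> {mpoly int[n]}.
Proof.
pose D : {mpoly int[n]} := 'X_(this_pos i) - 'X_(next_pos i).
pose Q f := exists g, g * D = f - msym (simple_tr i) f.
suff: Q f by case=> g gE; exists g; apply/eqP.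
have QC c : Q c%:MP.
  exists 0; rewrite mul0r; apply/esym/eqP; rewrite subr_eq0.
  by rewrite -[c%:MP]mulr1 mul_mpolyC msymZ -mpolyX0 msymX; apply/eqP;
     congr (_ *: 'X_[_]); apply/mnmP=> k; rewrite !mnmE.
have QD f1 f2 : Q f1 -> Q f2 -> Q (f1 + f2).
  move=> [g1 E1] [g2 E2]; exists (g1 + g2).
  by rewrite mulrDl E1 E2 msymD opprD addrACA.
have QM f1 f2 : Q f1 -> Q f2 -> Q (f1 * f2).
  move=> [g1 E1] [g2 E2]; exists (g1 * f2 + msym (simple_tr i) f1 * g2).
  rewrite mulrDl -mulrA [f2 * D]mulrC mulrA E1 -mulrA E2 msymM.
  by rewrite mulrBl mulrBr addrA subrK.
have QX k : Q 'X_k.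
  have E : msym (simple_tr i) 'X_k = 'X_(simple_tr i k) :> {mpoly int[n]}.
    rewrite msymX; congr 'X_[_]; apply/mnmP=> j.
    by rewrite !mnmE -(inj_eq (@perm_inj _ (simple_tr i))) permKV.
  rewrite /Q {}E /simple_tr; case: tpermP => [->|->|_ _].
  - by exists 1; rewrite mul1r.
  - by exists (-1); rewrite mulN1r opprB.
  - by exists 0; rewrite mul0r subrr.
elim/mpolyind: f => [|c m f _ _ IHf]; first by rewrite -mpolyC0; apply: QC.
apply: QD IHf; rewrite -mul_mpolyC; apply: (QM _ _ (QC c)).
rewrite mpolyXE_id; apply: (big_ind Q (QC 1) QM) => k _.
by elim: (m k) => [|e IHe]; [exact: (QC 1)|rewrite exprS; apply: QM].
Qed.

(* The divided difference: the exact quotient of f - s_i f by x_i - x_{i+1} in  *)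
(* the polynomial ring (an integral domain, so the quotient is unique).         *)
Definition ddiff i f : {mpoly int[n]} := xchoose (ddiff_subproof i f).

Lemma ddiffP i f :
  ddiff i f * ('X_(this_pos i) - 'X_(next_pos i)) = f - msym (simple_tr i) f.
Proof. exact/eqP/(xchooseP (ddiff_subproof i f)). Qed.

Definition demazure i f : {mpoly int[n]} := ddiff i ('X_(this_pos i) * f).

Definition demazure_perm (w : 'S_n) f : {mpoly int[n]} :=
  foldr demazure f (reduced_word w).

(* w sends b to c when c = (b_{w(1)}, ..., b_{w(n)}).  With the composition     *)
(* convention of perm_of_word this gives kappa_b = pi_i kappa_{s_i b} whenever  *)
(* b_i < b_{i+1}.                                                               *)
Definition perm_sends (w : 'S_n) b (c : n.-tuple nat) : bool :=
  [forall k, tnth b (w k) == tnth c k].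

Fact min_sorting_perm_subproof b :
  exists w, perm_sends w b (sort_comp b) &&
    [forall v, perm_sends v b (sort_comp b) ==>
               (perm_length w <= perm_length v)%N].
Proof.
have : perm_eq (sort_comp b) b by rewrite perm_sort.
case/tuple_permP=> w0 w0E.
have sends0 : perm_sends w0 b (sort_comp b).
  apply/forallP=> k; apply/eqP; rewrite [RHS](tnth_nth 0%N) w0E.
  by rewrite -tnth_nth tnth_mktuple.
case: (@arg_minnP _ w0 (fun w => perm_sends w b _) (@perm_length n) sends0) => w sends_w min_w.
by exists w; rewrite sends_w; apply/forallP=> v; apply/implyP/min_w.
Qed.

Definition min_sorting_perm b : 'S_n := xchoose (min_sorting_perm_subproof b).

Definition key_poly b : {mpoly int[n]} :=
  demazure_perm (min_sorting_perm b) (xpow (sort_comp b)).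

Definition young_key_poly (a : n.-tuple nat) : {mpoly int[n]} :=
  key_poly (rev_comp a) \mPo [tuple 'X_(rev_ord i) | i < n].

End KeyPolynomials.

Section Keys.
Variable n : nat.
Implicit Types (C D : seq 'I_n) (T : seq (seq 'I_n)) (a : n.-tuple nat).

(* Tableaux are drawn in the French way (rows weakly increase from left to      *)
(* right, columns strictly increase from bottom to top); a tableau is the list  *)
(* of its nonempty columns from left to right, each listed from bottom to top.  *)
(* zip truncates to the height of the right-hand column D.                      *)
Definition column C : bool :=
  (C != [::]) && sorted (fun i j : 'I_n => i < j) C.

Definition col_le C D : bool :=
  (size D <= size C) && all (fun p : 'I_n * 'I_n => p.1 <= p.2) (zip C D).

Definition semistandard T : bool := all column T && sorted col_le T.

Definition is_key T : bool :=
  semistandard T && sorted (fun C D => all (mem C) D) T.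

Definition has_weight T a : bool :=
  [forall i, count_mem i (flatten T) == tnth a i].

(* Reading down a column lists its entries in decreasing order. *)
Definition col_word T : seq 'I_n := flatten [seq rev C | C <- T].

Lemma subseq_col_le C D :
  sorted (fun i j : 'I_n => i < j) C -> subseq D C -> col_le C D.
Proof.
move=> sC sDC; rewrite /col_le size_subseq //=.
have shift c E F : path (fun i j : 'I_n => i < j) c E -> size F <= size E ->
    all (fun p : 'I_n * 'I_n => p.1 <= p.2) (zip E F) ->
    all (fun p : 'I_n * 'I_n => p.1 <= p.2) (zip (c :: E) F).
  elim: E F c => [|e E IHE] [|x F] c //= /andP[ce pE] szF /andP[ex leF].
  by rewrite (leq_trans (ltnW ce) ex); apply: IHE.
elim: C D sC sDC => [|c C IHC] [|d D] //= pC.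
have sC := path_sorted pC; case: eqP => [->|_] sDC.
  by rewrite leqnn IHC.
exact: (shift c C (d :: D) pC (size_subseq sDC) (IHC _ sC sDC)).
Qed.

Fact key_subproof a : exists T, is_key T && has_weight T a.
Proof.
pose r := \max_i tnth a i; pose col j := [seq i <- enum 'I_n | j < tnth a i].
have tr : transitive (fun i j : 'I_n => i < j) by move=> ? ? ?; apply: ltn_trans.
have col_sorted j : sorted (fun i j : 'I_n => i < j) (col j).
  apply: sorted_filter => //; rewrite -(@sorted_map _ _ val ltn) val_enum_ord.
  exact: iota_ltn_sorted.
have col_sub j : subseq (col j.+1) (col j).
  suff -> : col j.+1 = [seq i <- col j | j.+1 < tnth a i] by apply: filter_subseq.
  rewrite -filter_predI; apply: eq_filter => i /=.
  by case: ltnP => // /ltnW ->.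
have sorted_col (e : rel (seq 'I_n)) m p :
    (forall j, e (col j) (col j.+1)) -> sorted e [seq col j | j <- iota m p].
  move=> eP; case: p => //= p.
  by elim: p m => //= p IHp m; rewrite eP IHp.
exists [seq col j | j <- iota 0 r]; rewrite /is_key /semistandard -!andbA.
apply/and4P; split.
- apply/allP=> C /mapP[j]; rewrite mem_iota add0n /= => lt_jr ->.
  rewrite /column col_sorted andbT.
  have [i lt_ji|ge_a] := pickP (fun i => j < tnth a i).
    apply/eqP=> col0; have : i \in col j by rewrite mem_filter lt_ji mem_enum.
    by rewrite col0.
  case/negP: (negbT (ltnn j)); apply: leq_trans lt_jr _.
  by apply/bigmax_leqP=> i _; rewrite leqNgt ge_a.
- by apply: sorted_col => j; apply: subseq_col_le.
- by apply: sorted_col => j; apply/allP; apply: mem_subseq.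
apply/forallP=> i; apply/eqP; rewrite count_flatten -map_comp.
have le_ar : tnth a i <= r by apply: leq_bigmax.
transitivity (count (fun j => j < tnth a i) (iota 0 r)).
  rewrite -sumn_count; congr sumn; apply: eq_map => j /=.
  have uniq_col : uniq (col j) by apply/filter_uniq/enum_uniq.
  by rewrite (count_uniq_mem _ uniq_col) mem_filter mem_enum andbT.
rewrite -(subnKC le_ar) iotaD count_cat add0n.
rewrite (@eq_in_count _ _ predT) => [|j]; last by rewrite mem_iota.
rewrite count_predT size_iota (@eq_in_count _ _ pred0) => [|j].
  by rewrite count_pred0 addn0.
by rewrite mem_iota => /andP[+ _] /=; rewrite ltnNge => ->.
Qed.

Lemma key_unique a T1 T2 :
  is_key T1 && has_weight T1 a -> is_key T2 && has_weight T2 a -> T1 = T2.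
Proof.
have tr : transitive (fun i j : 'I_n => i < j) by move=> ? ? ?; apply: ltn_trans.
have irr : irreflexive (fun i j : 'I_n => i < j) by move=> i; apply: ltnn.
have tl C T : is_key (C :: T) -> is_key T.
  case/andP=> /andP[/= /andP[_ cT] /path_sorted sT] /path_sorted kT.
  by rewrite /is_key /semistandard cT sT kT.
have ne C T : is_key (C :: T) -> exists i, i \in C.
  case/andP=> /andP[/= /andP[/andP[C0 _] _] _] _.
  by case: C C0 => // i C _; exists i; rewrite mem_head.
have uC C T : is_key (C :: T) -> sorted (fun i j : 'I_n => i < j) C.
  by case/andP=> /andP[/= /andP[/andP[]]].
have supp C T i : is_key (C :: T) -> (0 < count_mem i (flatten (C :: T))) = (i \in C).
  case/andP=> _ /= kT; rewrite -has_count has_pred1 mem_cat.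
  apply/orb_idr; elim: T C kT => //= D T IHT C /andP[/allP sDC kT].
  by rewrite mem_cat => /orP[/sDC //|/(IHT _ kT)/sDC].
move=> /andP[k1 /forallP w1] /andP[k2 /forallP w2].
have {w1 w2} w12 i : count_mem i (flatten T1) = count_mem i (flatten T2).
  by rewrite (eqP (w1 i)) (eqP (w2 i)).
elim: T1 T2 k1 k2 w12 => [|C1 T1 IHT] [|C2 T2] // k1 k2 w12.
- by have [i] := ne _ _ k2; rewrite -(supp _ _ _ k2) -w12.
- by have [i] := ne _ _ k1; rewrite -(supp _ _ _ k1) w12.
have C12 : C1 = C2.
  apply: (irr_sorted_eq tr irr (uC _ _ k1) (uC _ _ k2)) => i.
  by rewrite -(supp _ _ _ k1) -(supp _ _ _ k2) w12.
congr cons => //; apply: IHT (tl _ _ k1) (tl _ _ k2) _ => i.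
by have := w12 i; rewrite /= !count_cat C12; apply: addnI.
Qed.

Definition key a : seq (seq 'I_n) := xchoose (key_subproof a).

End Keys.

Section Words.
Variables (n p : nat).
Implicit Types (c w u v : p.-tuple 'I_n).

(* y x z -> y z x  when x < y <= z,   and   x z y -> z x y  when x <= y < z *)
Definition knuth_triple (s t : seq 'I_n) : bool :=
  match s, t with
  | [:: s1; s2; s3], [:: t1; t2; t3] =>
      [&& t1 == s1, t2 == s3, t3 == s2, s2 < s1 & s1 <= s3]
      || [&& t1 == s2, t2 == s1, t3 == s3, s1 <= s3 & s3 < s2]
  | _, _ => false
  end.

Definition knuth_step u v : bool :=
  [exists i : 'I_p,
    [&& take i u == take i v, drop i.+3 u == drop i.+3 v
      & knuth_triple (take 3 (drop i u)) (take 3 (drop i v))]].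

(* Knuth equivalence preserves the length, so it is set up on words of a given  *)
(* length p.                                                                    *)
Definition knuth : rel (p.-tuple 'I_n) :=
  connect (fun u v => knuth_step u v || knuth_step v u).

Definition flip_word w : p.-tuple 'I_n := [tuple of map (@rev_ord n) w].

Definition compatible c w : bool :=
  [&& [forall j : 'I_p, forall k : 'I_p, (j <= k) ==> (tnth w j <= tnth w k)],
      [forall j : 'I_p, forall k : 'I_p,
         (k == j.+1 :> nat) ==> (tnth c j < tnth c k)
           ==> (tnth w j < tnth w k)]
    & [forall k : 'I_p, tnth w k <= tnth c k]].

Definition word_comp w : n.-tuple nat := [tuple count_mem i w | i < n].

End Words.

(* Main.v *)
Require Import Defs.
From mathcomp Require Import all_boot all_order all_fingroup all_algebra.
From mathcomp Require Import mpoly zify.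

Set Implicit Arguments.
Unset Strict Implicit.
Unset Printing Implicit Defensive.

Import GRing.Theory.

(* Flipping the words turns the right-hand side into a sum over biwords whose   *)
(* lower word is Knuth equivalent to the key word and is cut by the weakly      *)
(* decreasing upper word into weakly increasing rows, the letters of row [j]    *)
(* being at most [j].  Two crystal structures act on biwords: exchanging the    *)
(* letters [i] and [i+1] of the lower word maps the Knuth class of [key a] to   *)
(* that of [key (s_i a)], and moving a letter between the rows [i] and [i+1]    *)
(* preserves Knuth classes.  When [a_i > a_(i+1)] the biwords for [key a] form  *)
(* full strings of the second structure; those for [key (s_i a)] correspond to  *)
(* a subset that meets every string in the whole string or in one extremal      *)
(* element.  This is how the Demazure operator acts on monomials, so it maps    *)
(* the sum for [s_i a] to the sum for [a].  The recursion starts at increasing  *)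
(* [a], where the only biword is the diagonal one, and it follows a shortest    *)
(* sorting word, each letter of which removes exactly one ascent.               *)

(** * Plactic equivalence *)

Inductive plactic : seq nat -> seq nat -> Prop :=
| plactic_refl u : plactic u u
| plactic_sym u v : plactic u v -> plactic v u
| plactic_trans v u w : plactic u v -> plactic v w -> plactic u w
| plactic_yxz s t x y z : x < y -> y <= z ->
    plactic (s ++ [:: y; x; z] ++ t) (s ++ [:: y; z; x] ++ t)
| plactic_xzy s t x y z : x <= y -> y < z ->
    plactic (s ++ [:: x; z; y] ++ t) (s ++ [:: z; x; y] ++ t).

Lemma plactic_ctx s t u v : plactic u v -> plactic (s ++ u ++ t) (s ++ v ++ t).
Proof.
elim=> {u v} [u|u v _|v u w _ + _|s' t' x y z lt_xy le_yz|s' t' x y z le_xy lt_yz].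
- exact: plactic_refl.
- exact: plactic_sym.
- exact: plactic_trans.
- by rewrite -!catA !(catA s); apply: plactic_yxz.
- by rewrite -!catA !(catA s); apply: plactic_xzy.
Qed.

Lemma plactic_catl s u v : plactic u v -> plactic (s ++ u) (s ++ v).
Proof. by move/(plactic_ctx s [::]); rewrite !cats0. Qed.

Lemma plactic_catr t u v : plactic u v -> plactic (u ++ t) (v ++ t).
Proof. exact: plactic_ctx [::] t u v. Qed.

Lemma plactic_perm u v : plactic u v -> perm_eq u v.
Proof.
elim=> {u v} [u|u v _|v u w _ + _|s t x y z _ _|s t x y z _ _] //.
- by rewrite perm_sym.
- exact: perm_trans.
- by rewrite perm_cat2l perm_cat2r; apply/seq.permP=> p /=; lia.
- by rewrite perm_cat2l perm_cat2r; apply/seq.permP=> p /=; lia.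
Qed.

Lemma plactic_shift_small z R y :
  path leq z R -> y < z -> plactic (z :: R ++ [:: y]) (z :: y :: R).
Proof.
elim: R z => [|r R IH] z /=; first by move=> *; apply: plactic_refl.
case/andP=> le_zr pR lt_yz.
apply: (@plactic_trans (z :: r :: y :: R)).
  by apply: (plactic_catl [:: z]); apply: IH => //; apply: leq_trans le_zr.
by apply/plactic_sym/(@plactic_yxz [::] R).
Qed.

Lemma plactic_shift_large R y z :
  sorted leq (rcons R y) -> y < z -> plactic (R ++ [:: z; y]) (z :: rcons R y).
Proof.
move=> sR lt_yz; elim: R sR => [|r R IH] /= pR; first by move=> *; apply: plactic_refl.
have sR := path_sorted pR.
apply: (@plactic_trans (r :: z :: rcons R y)).
  exact: (plactic_catl [:: r]) (IH sR).
have max_y : all (geq y) (rcons R y).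
  rewrite all_rcons /= leqnn /=.
  by move: sR; rewrite -cats1 sorted_pairwise ?pairwise_cat; [case/andP; rewrite allrel1r | exact: leq_trans].
case E: (rcons R y) pR max_y => [|h R'] /=; first by case: (R) E.
by case/andP=> le_rh _ /andP[le_hy _]; apply: (@plactic_xzy [::]) => //; apply: leq_ltn_trans lt_yz.
Qed.

(* Schensted's row insertion of [y], which bumps [z]. *)
Lemma plactic_bump R1 R2 y z :
  sorted leq (rcons R1 y) -> y < z -> path leq z R2 ->
  plactic (R1 ++ z :: R2 ++ [:: y]) (z :: R1 ++ y :: R2).
Proof.
move=> sR1 lt_yz pR2.
apply: plactic_trans (plactic_catl R1 (plactic_shift_small pR2 lt_yz)) _.
by have := plactic_catr R2 (plactic_shift_large sR1 lt_yz); rewrite -!catA /= cat_rcons.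
Qed.

Fixpoint above (R S : seq nat) : bool :=
  match R, S with
  | [::], _ => true
  | r :: R', s :: S' => (s < r) && above R' S'
  | _ :: _, [::] => false
  end.

Lemma sorted_leq_cat u v :
  sorted leq (u ++ v) = [&& sorted leq u, sorted leq v & allrel leq u v].
Proof. by rewrite !(sorted_pairwise leq_trans) pairwise_cat; do !bool_congr. Qed.

Lemma plactic_raise Y R S : sorted leq (Y ++ R) -> sorted leq (Y ++ S) ->
  above R S -> plactic (Y ++ R ++ S) (R ++ Y ++ S).
Proof.
elim: R Y S => [|r R IH] Y S; first by move=> *; apply: plactic_refl.
case: S => //= s S sYR sYS /andP[lt_sr aRS].
have sYs : sorted leq (rcons Y s ++ S) by rewrite cat_rcons.
move: (sYR) (sYS) (sYs); rewrite !sorted_leq_cat /= => /and3P[sY pR /allrelP lYR] /and3P[_ pS _].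
case/and3P=> sYs' _ _.
apply: (@plactic_trans (r :: rcons Y s ++ R ++ S)).
  by have := plactic_catr S (plactic_bump sYs' lt_sr pR); rewrite -!catA /= -!catA cat_rcons.
have := IH (rcons Y s) S; rewrite !cat_rcons.
move/(_ _ sYS aRS)/(plactic_catl [:: r]); apply.
rewrite -cat_rcons sorted_leq_cat sYs' (path_sorted pR) /=; apply/allrelP=> x t.
have le_t : t \in R -> r <= t.
  by move: pR; rewrite path_sortedE; [case/andP=> /allP le_r _ /le_r | exact: leq_trans].
rewrite mem_rcons inE => /predU1P[->|Yx] Rt; first exact: leq_trans (ltnW lt_sr) (le_t Rt).
by apply: lYR => //; rewrite inE Rt orbT.
Qed.

Lemma plactic_lower Y R S : sorted leq (rev R ++ Y) -> sorted leq (rev S ++ Y) ->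
  size R = size S -> above R S -> plactic (rev R ++ Y ++ rev S) (rev R ++ rev S ++ Y).
Proof.
elim: R Y S => [|r R IH] Y [|s S] //; first by move=> *; rewrite cats0; apply: plactic_refl.
rewrite !rev_cons !cat_rcons => sRY sSY [eq_sz] /= /andP[lt_sr aRS].
have [pY sS] : path leq r Y /\ sorted leq (rcons (rev S) s).
  split; first by move: sRY; rewrite sorted_leq_cat => /and3P[].
  by move: sSY; rewrite -cat_rcons sorted_leq_cat => /and3P[].
apply: (@plactic_trans (rev R ++ (r :: Y) ++ rev S ++ [:: s])).
  by rewrite -cats1; apply: plactic_refl.
have sSr : sorted leq (rev S ++ r :: Y).
  move: sS; rewrite -cats1 !sorted_leq_cat /= pY => /andP[->].
  rewrite allrel1r => /allP le_s; apply/allrelP=> x t /le_s le_xs.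
  rewrite inE => /predU1P[->|Yt]; first exact: leq_trans (ltnW lt_sr).
  move: pY; rewrite path_sortedE; last exact: leq_trans.
  by case/andP=> /allP/(_ _ Yt) le_rt _; apply: leq_trans le_xs (leq_trans (ltnW lt_sr) le_rt).
have := plactic_catr [:: s] (IH (r :: Y) S sRY sSr eq_sz aRS).
rewrite -!catA => /plactic_trans; apply.
apply: plactic_catl.
exact: (plactic_bump sS lt_sr pY).
Qed.

(* The raising operator on two consecutive rows moves [y] from the upper row    *)
(* (read first) to the lower one; the size and [above] hypotheses say that [y]  *)
(* is the unmatched entry it acts on.                                           *)
Lemma plactic_two_rows R1a R1b R2 S1 S2 y :
  sorted leq (R1a ++ rev R1b ++ y :: R2) -> sorted leq (rev S1 ++ y :: S2) ->
  sorted leq (y :: R2) -> 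
  all (geq y) S1 -> size R1b = size S1 -> above R1b S1 -> above R2 S2 ->
  plactic (R1a ++ rev R1b ++ y :: R2 ++ rev S1 ++ S2)
          (R1a ++ rev R1b ++ R2 ++ rev S1 ++ y :: S2).
Proof.
rewrite sorted_leq_cat => /and3P[_ sR _] sS sYR leS eq_sz aR1 aR2.
apply: plactic_catl.
have sSR : sorted leq (rev S1 ++ y :: R2).
  move: sS; rewrite !sorted_leq_cat sYR => /and3P[-> _ _] /=.
  apply/allrelP=> x t; rewrite mem_rev => /(allP leS) /= le_xy.
  rewrite inE => /predU1P[->//|Rt].
  by move: sYR; rewrite /= path_sortedE; [case/andP=> /allP/(_ _ Rt)/(leq_trans le_xy) | exact: leq_trans].
have drop_y u v : sorted leq (u ++ y :: v) -> sorted leq (u ++ v).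
  by apply: subseq_sorted; [exact: leq_trans | rewrite subseq_cat2l subseq_cons].
have := plactic_catr S2 (plactic_lower sR sSR eq_sz aR1).
rewrite -!catA /= => /plactic_trans; apply.
have := plactic_catr (y :: S2) (plactic_lower (drop_y _ _ sR) (drop_y _ _ sSR) eq_sz aR1).
rewrite -!catA => /plactic_sym; apply: plactic_trans.
do 2!apply: plactic_catl.
apply: (plactic_raise (Y := [:: y])) => //.
by move: sS; rewrite sorted_leq_cat => /and3P[].
Qed.

(** * Bracketing of the letters i and i+1 *)

Section Brackets.
Variable i : nat.
Implicit Types (u v w : seq nat) (x d e : nat).

Let nSi : (i.+1 == i) = false := gtn_eqF (ltnSn i).
Let niS : (i == i.+1) = false := ltn_eqF (ltnSn i).

Definition open_step d x := if x == i.+1 then d.+1 else if x == i then d.-1 else d.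
Definition close_step x e := if x == i then e.+1 else if x == i.+1 then e.-1 else e.

(* A letter [i.+1] opens a bracket and a later letter [i] closes it; [opens d u] *)
(* counts the brackets left open by [u] after [d] open ones, [closes e u] the    *)
(* closing ones not matched in [u] nor among the [e] that follow it.             *)
Definition opens d u := foldl open_step d u.
Definition closes e u := foldr close_step e u.

Fixpoint promote d u :=
  if u is x :: u' then
    (if (x == i) && (d == 0) then i.+1 else x) :: promote (open_step d x) u'
  else [::].

Fixpoint demote e u :=
  if u is x :: u' then
    (if (x == i.+1) && (closes e u' == 0) then i else x) :: demote e u'
  else [::].

Lemma opens_cat d u v : opens d (u ++ v) = opens (opens d u) v.
Proof. exact: foldl_cat. Qed.

Lemma closes_cat e u v : closes e (u ++ v) = closes (closes e v) u.
Proof. exact: foldr_cat. Qed.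

Lemma promote_cat d u v : promote d (u ++ v) = promote d u ++ promote (opens d u) v.
Proof. by elim: u d => //= x u IH d; rewrite IH. Qed.

Lemma demote_cat e u v : demote e (u ++ v) = demote (closes e v) u ++ demote e v.
Proof. by elim: u => //= x u ->; rewrite closes_cat. Qed.

Lemma size_promote d u : size (promote d u) = size u.
Proof. by elim: u d => //= x u IH d; rewrite IH. Qed.

Lemma size_demote e u : size (demote e u) = size u.
Proof. by elim: u => //= x u ->. Qed.

Lemma opensE d u : opens d u = opens 0 u + (d - closes 0 u).
Proof.
elim: u d => //= [|x u IH] d; first by rewrite subn0.
rewrite !(IH (open_step _ x)) /open_step /close_step.
by case: (eqVneq x i.+1) => [->|_]; case: eqP; lia.
Qed.

Lemma closesE e u : closes e u = closes 0 u + (e - opens 0 u).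
Proof.
elim: u => //= [|x u IH]; first by rewrite subn0.
rewrite IH !(opensE (open_step _ x)) /open_step /close_step.
by case: (eqVneq x i.+1) => [->|_]; case: eqP; lia.
Qed.

Lemma count_opens_closes u :
  count_mem i u + opens 0 u = count_mem i.+1 u + closes 0 u.
Proof.
elim: u => //= x u IH; rewrite (opensE (open_step _ x)) /open_step /close_step.
by case: (eqVneq x i.+1) => [->|_]; case: eqP; lia.
Qed.

Lemma promoteK d u : (closes (opens d u) (promote d u) = d) * (demote (opens d u) (promote d u) = u).
Proof.
elim: u d => //= x u IH d; have [-> ->] := IH (open_step d x).
rewrite /open_step /close_step; case: (eqVneq x i.+1) => [->|nx1].
  by rewrite ?nSi eqxx.
case: (eqVneq x i) => [->|nxi]; last by rewrite ?(negPf nx1) ?(negPf nxi) /= ?(negPf nx1) ?(negPf nxi) ?IH1 ?IH2.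
by case: d => [|d] /=; rewrite ?eqxx ?nSi ?niS ?eqxx.
Qed.

Lemma demoteK e u : (opens (closes e u) (demote e u) = e) * (promote (closes e u) (demote e u) = u).
Proof.
elim: u => //= x u [IH1 IH2].
rewrite /open_step /close_step; case: (eqVneq x i.+1) => [->|nx1] /=.
  by case: (closes e u) IH1 IH2 => [|f] IH1 IH2; rewrite ?nSi ?niS ?eqxx /= ?nSi ?niS ?eqxx /= ?IH1 ?IH2.
case: (eqVneq x i) => [->|nxi]; last by rewrite ?(negPf nx1) ?(negPf nxi) /= ?(negPf nx1) ?(negPf nxi) ?IH1 ?IH2.
by rewrite niS /= IH1 IH2.
Qed.

Lemma promote0K u : opens 0 u = 0 -> demote 0 (promote 0 u) = u.
Proof. by move=> u0; have [_] := promoteK 0 u; rewrite u0. Qed.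

Lemma demote0K u : closes 0 u = 0 -> promote 0 (demote 0 u) = u.
Proof. by move=> u0; have [_] := demoteK 0 u; rewrite u0. Qed.

Lemma demote_id e u : opens 0 u = 0 -> demote e u = u.
Proof.
elim: u e => //= x u IH e; rewrite opensE => /eqP; rewrite addn_eq0 => /andP[/eqP u0 lt].
rewrite IH // closesE u0; congr cons; case: andP => // -[/eqP xi /eqP].
by move: lt; rewrite /open_step xi eqxx; lia.
Qed.

Lemma promote_id d u : closes 0 u = 0 -> promote d u = u.
Proof.
elim/last_ind: u => // u x IH; rewrite -cats1 closes_cat promote_cat /= => u0.
have u0' : closes 0 u = 0 by move: u0; rewrite closesE; lia.
rewrite IH //; case: andP => // -[/eqP xi /eqP].
by move: u0; rewrite closesE (opensE d) /close_step xi eqxx; lia.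
Qed.

Ltac plactic3 :=
  first [ exact: plactic_refl
        | apply: (@plactic_yxz [::] [::]); lia
        | apply: (@plactic_xzy [::] [::]); lia
        | apply/plactic_sym/(@plactic_yxz [::] [::]); lia
        | apply/plactic_sym/(@plactic_xzy [::] [::]); lia ].

Ltac bracket_cases := 
  repeat match goal with |- context [?a == ?b] => case: (@eqP _ a b) => ? end;
  subst; try lia; split; first [lia | plactic3].

Lemma promote_yxz x y z d : x < y -> y <= z ->
  opens d [:: y; x; z] = opens d [:: y; z; x] /\
  plactic (promote d [:: y; x; z]) (promote d [:: y; z; x]).
Proof. by move=> lt_xy le_yz; rewrite /= /open_step; bracket_cases. Qed.

Lemma promote_xzy x y z d : x <= y -> y < z ->
  opens d [:: x; z; y] = opens d [:: z; x; y] /\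
  plactic (promote d [:: x; z; y]) (promote d [:: z; x; y]).
Proof. by move=> le_xy lt_yz; rewrite /= /open_step; bracket_cases. Qed.

Lemma demote_yxz x y z e : x < y -> y <= z ->
  closes e [:: y; x; z] = closes e [:: y; z; x] /\
  plactic (demote e [:: y; x; z]) (demote e [:: y; z; x]).
Proof. by move=> lt_xy le_yz; rewrite /= /close_step; bracket_cases. Qed.

Lemma demote_xzy x y z e : x <= y -> y < z ->
  closes e [:: x; z; y] = closes e [:: z; x; y] /\
  plactic (demote e [:: x; z; y]) (demote e [:: z; x; y]).
Proof. by move=> le_xy lt_yz; rewrite /= /close_step; bracket_cases. Qed.

Lemma plactic_promote d u v : plactic u v ->
  opens d u = opens d v /\ plactic (promote d u) (promote d v).
Proof.
move=> uv; elim: uv d => {u v} [u|u v _ IH|v u w _ IH1 _ IH2|s t x y z lt le|s t x y z le lt] d.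
- by split=> //; apply: plactic_refl.
- by have [-> ?] := IH d; split=> //; apply: plactic_sym.
- by have [-> uv] := IH1 d; have [-> vw] := IH2 d; split=> //; apply: plactic_trans vw.
- have [eo pl] := promote_yxz (opens d s) lt le.
  by rewrite !promote_cat !opens_cat -eo; split=> //; apply: plactic_ctx.
- have [eo pl] := promote_xzy (opens d s) le lt.
  by rewrite !promote_cat !opens_cat -eo; split=> //; apply: plactic_ctx.
Qed.

Lemma plactic_demote e u v : plactic u v ->
  closes e u = closes e v /\ plactic (demote e u) (demote e v).
Proof.
move=> uv; elim: uv e => {u v} [u|u v _ IH|v u w _ IH1 _ IH2|s t x y z lt le|s t x y z le lt] e.
- by split=> //; apply: plactic_refl.
- by have [-> ?] := IH e; split=> //; apply: plactic_sym.
- by have [-> uv] := IH1 e; have [-> vw] := IH2 e; split=> //; apply: plactic_trans vw.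
- have [eo pl] := demote_yxz (closes e t) lt le.
  by rewrite !demote_cat !closes_cat -eo; split=> //; apply: plactic_ctx.
- have [eo pl] := demote_xzy (closes e t) le lt.
  by rewrite !demote_cat !closes_cat -eo; split=> //; apply: plactic_ctx.
Qed.

End Brackets.

Section Raising.
Variable i : nat.
Implicit Types (u v w : seq nat) (x d e : nat).
Let nSi : (i.+1 == i) = false := gtn_eqF (ltnSn i).
Let niS : (i == i.+1) = false := ltn_eqF (ltnSn i).

(* An opening bracket is unmatched when no closing one is pending after it, so  *)
(* this turns the leftmost unmatched opening bracket into a closing one.        *)
Fixpoint raise u :=
  if u is x :: u' then
    if (x == i.+1) && (closes i 0 u' == 0) then i :: u' else x :: raise u'
  else [::].

Lemma size_raise u : size (raise u) = size u.
Proof. by elim: u => //= x u IH; case: ifP => //= _; rewrite IH. Qed.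

Lemma raise_split u : 0 < opens i 0 u -> exists u1 u2,
  [/\ u = u1 ++ i.+1 :: u2, raise u = u1 ++ i :: u2,
      opens i 0 u1 = 0 & closes i 0 u2 = 0].
Proof.
elim: u => //= x u IH; rewrite opensE /open_step.
case: (eqVneq x i.+1) => [->|nx1] /=; last first.
  rewrite (_ : (if _ then _ else _) = 0) ?addn0 => [{}/IH[u1 [u2 [-> -> o1 c2]]]|]; last by case: ifP.
  by exists (x :: u1), u2; split=> //=; rewrite /open_step (negPf nx1); case: ifP.
case: eqP => [c0 _|/eqP]; first by exists [::], u.
rewrite -lt0n => c0; rewrite (_ : 1 - _ = 0) ?addn0; last by lia.
move=> /IH[u1 [u2 [uE -> o1 c2]]]; exists (i.+1 :: u1), u2; split=> //=; first by rewrite uE.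
move: c0; rewrite uE closes_cat /= c2 /close_step nSi eqxx /= => c0.
by rewrite /open_step eqxx opensE; lia.
Qed.

Lemma unraise_split v : 0 < closes i 0 v -> exists v1 v2,
  [/\ v = v1 ++ i :: v2, opens i 0 v1 = 0 & closes i 0 v2 = 0].
Proof.
elim/last_ind: v => // v x IH; rewrite -cats1 closes_cat closesE /= /close_step.
case: (eqVneq x i) => [->|nxi] /=; last first.
  rewrite (_ : (if _ then _ else _) = 0) ?addn0 => [{}/IH[v1 [v2 [-> o1 c2]]]|]; last by case: ifP.
  exists v1, (v2 ++ [:: x]); rewrite -catA closes_cat /= /close_step (negPf nxi).
  by split=> //; case: ifP.
have [o0 _|o0] := posnP (opens i 0 v); first by exists v, [::].
rewrite (_ : 1 - _ = 0) ?addn0; last by lia.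
move=> /IH[v1 [v2 [vE o1 c2]]]; exists v1, (v2 ++ [:: i]); split=> //.
  by rewrite vE -catA.
move: o0; rewrite vE opens_cat /= o1 /open_step niS eqxx /= => o0.
by rewrite closes_cat closesE /= /close_step eqxx; lia.
Qed.

Lemma bracket_position_unique x u1 u2 v1 v2 :
  x \in [:: i; i.+1] -> u1 ++ x :: u2 = v1 ++ x :: v2 ->
  opens i 0 u1 = 0 -> closes i 0 u2 = 0 -> opens i 0 v1 = 0 -> closes i 0 v2 = 0 ->
  u1 = v1.
Proof.
move=> x_i; wlog le_uv : u1 u2 v1 v2 / size u1 <= size v1.
  move=> W; have [le|lt] := leqP (size u1) (size v1); first exact: W.
  by move=> E *; apply/esym/(W v1 v2 u1 u2) => //; apply: ltnW.
move=> E o1 c2 o1' c2'.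
have [eq_sz|ne_sz] := eqVneq (size u1) (size v1).
  by have := congr1 (take (size u1)) E; rewrite take_size_cat // eq_sz take_size_cat.
have lt_sz : size u1 < size v1 by rewrite ltn_neqAle ne_sz.
have : drop (size u1).+1 (u1 ++ x :: u2) = u2 by rewrite -cat_rcons drop_size_cat // size_rcons.
have : take (size u1).+1 (u1 ++ x :: u2) = rcons u1 x by rewrite -cat_rcons take_size_cat // size_rcons.
rewrite E take_cat drop_cat; case: (ltngtP (size u1).+1 (size v1)) lt_sz => // [lt_sz _|eq_sz _]; last first.
  rewrite eq_sz subnn /= cats0 => v1E u2E.
  move: o1' c2; rewrite v1E -u2E -cats1 opens_cat o1 /= c2'.
  by move: x_i; rewrite !inE => /orP[]/eqP->; rewrite /open_step /close_step ?eqxx ?niS ?nSi.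
set m := drop _ v1 => v1E u2E.
move: o1' c2; rewrite -(cat_take_drop (size u1).+1 v1) -/m v1E -u2E -cats1.
rewrite !opens_cat closes_cat /= o1 c2' opensE closesE.
by move: x_i; rewrite !inE => /orP[]/eqP->; rewrite /open_step /close_step ?eqxx ?niS ?nSi ?(closesE i 1 m) /=; lia.
Qed.

Lemma raise_inj u v : 0 < opens i 0 u -> 0 < opens i 0 v -> raise u = raise v -> u = v.
Proof.
move=> /raise_split[u1 [u2 [-> -> o1 c2]]] /raise_split[v1 [v2 [-> -> o1' c2']]] E.
have Ev := bracket_position_unique (mem_head _ _) E o1 c2 o1' c2'.
by move/eqP: E; rewrite Ev eqseq_cat // => /andP[_ /eqP[->]].
Qed.

Lemma raise_cat u1 u2 : opens i 0 u1 = 0 -> closes i 0 u2 = 0 ->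
  raise (u1 ++ i.+1 :: u2) = u1 ++ i :: u2.
Proof.
move=> o1 c2; have : 0 < opens i 0 (u1 ++ i.+1 :: u2).
  by rewrite opens_cat o1 /= /open_step eqxx opensE c2; lia.
move=> /raise_split[v1 [v2 [E -> o1' c2']]].
have Ev : u1 = v1 by apply: (bracket_position_unique _ E) => //; rewrite !inE eqxx orbT.
by move/eqP: E; rewrite Ev eqseq_cat // => /andP[_ /eqP[->]].
Qed.

Lemma opens_raise u1 u2 : opens i 0 u1 = 0 -> closes i 0 u2 = 0 ->
  opens i 0 (u1 ++ i.+1 :: u2) = (opens i 0 (u1 ++ i :: u2)).+1.
Proof. by move=> o1 c2; rewrite !opens_cat o1 /= /open_step eqxx niS eqxx /= (opensE i 1) c2; lia. Qed.

Lemma closes_raise u1 u2 : opens i 0 u1 = 0 -> closes i 0 u2 = 0 ->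
  closes i 0 (u1 ++ i :: u2) = (closes i 0 (u1 ++ i.+1 :: u2)).+1.
Proof. by move=> o1 c2; rewrite !closes_cat /= c2 /close_step eqxx nSi eqxx /= (closesE i 1) o1; lia. Qed.

Lemma demote_raise u1 u2 : opens i 0 u1 = 0 -> closes i 0 u2 = 0 ->
  demote i 0 (u1 ++ i.+1 :: u2) = demote i 0 (u1 ++ i :: u2).
Proof.
by move=> o1 c2; rewrite !demote_cat /= c2 /close_step eqxx niS nSi eqxx /= !(demote_id _ o1).
Qed.

Lemma promote_raise u1 u2 : opens i 0 u1 = 0 -> closes i 0 u2 = 0 ->
  promote i 0 (u1 ++ i.+1 :: u2) = promote i 0 (u1 ++ i :: u2).
Proof.
by move=> o1 c2; rewrite !promote_cat /= o1 /open_step !eqxx niS nSi /= !(promote_id _ c2).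
Qed.

Lemma demote_closure (P : seq nat -> Prop) u :
  (forall u1 u2, opens i 0 u1 = 0 -> closes i 0 u2 = 0 ->
     P (u1 ++ i.+1 :: u2) -> P (u1 ++ i :: u2)) ->
  P u -> P (demote i 0 u).
Proof.
move=> step; have [m] := ubnP (opens i 0 u); elim: m u => // m IH u lt_um Pu.
have [u0|/raise_split[u1 [u2 [uE _ o1 c2]]]] := posnP (opens i 0 u); first by rewrite demote_id.
rewrite uE demote_raise //; apply: IH; last by apply: step => //; rewrite -uE.
by move: lt_um; rewrite uE opens_raise.
Qed.

Lemma promote_closure (P : seq nat -> Prop) u :
  (forall u1 u2, opens i 0 u1 = 0 -> closes i 0 u2 = 0 ->
     P (u1 ++ i :: u2) -> P (u1 ++ i.+1 :: u2)) ->
  P u -> P (promote i 0 u).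
Proof.
move=> step; have [m] := ubnP (closes i 0 u); elim: m u => // m IH u lt_um Pu.
have [u0|/unraise_split[u1 [u2 [uE o1 c2]]]] := posnP (closes i 0 u); first by rewrite promote_id.
rewrite uE -promote_raise //; apply: IH; last by apply: step => //; rewrite -uE.
by move: lt_um; rewrite uE closes_raise.
Qed.

Lemma opens_demote u : opens i 0 (demote i 0 u) = 0.
Proof.
have [m] := ubnP (opens i 0 u); elim: m u => // m IH u lt_um.
have [u0|/raise_split[u1 [u2 [uE _ o1 c2]]]] := posnP (opens i 0 u); first by rewrite demote_id.
by rewrite uE demote_raise //; apply: IH; move: lt_um; rewrite uE opens_raise.
Qed.

Lemma closes_promote u : closes i 0 (promote i 0 u) = 0.
Proof.
have [m] := ubnP (closes i 0 u); elim: m u => // m IH u lt_um.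
have [u0|/unraise_split[u1 [u2 [uE o1 c2]]]] := posnP (closes i 0 u); first by rewrite promote_id.
by rewrite uE -promote_raise //; apply: IH; move: lt_um; rewrite uE closes_raise.
Qed.

Definition swap x := if x == i then i.+1 else if x == i.+1 then i else x.

Lemma count_demote u k : closes i 0 u = 0 ->
  count_mem k (demote i 0 u) = count_mem (swap k) u.
Proof.
move=> u0; pose P v := [/\ count_mem i v + count_mem i.+1 v = count_mem i u + count_mem i.+1 u,
  opens i 0 v + closes i 0 v = opens i 0 u &
  forall k, k != i -> k != i.+1 -> count_mem k v = count_mem k u].
have [] : P (demote i 0 u).
  apply: (@demote_closure P); last by split; rewrite ?u0 ?addn0.
  move=> u1 u2 o1 c2 [E1 E2 E3]; split.
  - by move: E1; rewrite !count_cat /= !eqxx nSi niS; lia.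
  - by move: E2; rewrite (closes_raise o1 c2) (opens_raise o1 c2); lia.
  - by move=> l nli nlS; rewrite -E3 // !count_cat /= ![_ == l]eq_sym (negPf nli) (negPf nlS).
move=> E1 E2 E3; have := count_opens_closes i (demote i 0 u); have := count_opens_closes i u.
rewrite u0 opens_demote in E2 *; rewrite /swap.
case: eqP => [->|/eqP nki]; first by lia.
case: eqP => [->|/eqP nkS]; first by lia.
by rewrite (E3 k).
Qed.

End Raising.

(** * Biwords and their rows *)

Definition by_row (p q : nat * nat) :=
  (q.1 < p.1) || ((p.1 == q.1) && (p.2 <= q.2)).
Definition by_letter (p q : nat * nat) :=
  (q.2 < p.2) || ((p.2 == q.2) && (p.1 <= q.1)).

Lemma by_row_trans : transitive by_row.
Proof. by move=> [a b] [c d] [e f]; rewrite /by_row /=; lia. Qed.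

Lemma by_letter_trans : transitive by_letter.
Proof. by move=> [a b] [c d] [e f]; rewrite /by_letter /=; lia. Qed.

Lemma by_row_total : total by_row.
Proof. by move=> [a b] [c d]; rewrite /by_row /=; lia. Qed.

Lemma by_letter_total : total by_letter.
Proof. by move=> [a b] [c d]; rewrite /by_letter /=; lia. Qed.

Lemma by_row_anti : antisymmetric by_row.
Proof. by move=> [a b] [c d]; rewrite /by_row /= => h; congr pair; lia. Qed.

Lemma by_letter_anti : antisymmetric by_letter.
Proof. by move=> [a b] [c d]; rewrite /by_letter /= => h; congr pair; lia. Qed.

Lemma sort_by_row_perm s t : perm_eq s t -> sort by_row s = sort by_row t.
Proof. by move/(perm_sortP by_row_total by_row_trans by_row_anti). Qed.

Lemma sort_by_letter_perm s t : perm_eq s t -> sort by_letter s = sort by_letter t.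
Proof. by move/(perm_sortP by_letter_total by_letter_trans by_letter_anti). Qed.

Lemma sort_by_row_id s : sorted by_row s -> sort by_row s = s.
Proof. exact: (sorted_sort by_row_trans). Qed.

Lemma sort_by_letter_id s : sorted by_letter s -> sort by_letter s = s.
Proof. exact: (sorted_sort by_letter_trans). Qed.

Lemma sorted_split (T : eqType) (leT : rel T) (P : pred T) s :
  transitive leT -> (forall x y, leT x y -> P y -> P x) -> sorted leT s ->
  s = filter P s ++ filter (predC P) s.
Proof.
move=> tr down; elim: s => //= x s IH pxs; case: ifP => Px /=.
  by rewrite -IH //; apply: path_sorted pxs.
rewrite (_ : filter P s = [::]) /=; last first.
  rewrite -(filter_pred0 s); apply: eq_in_filter => y sy /=.
  apply: contraFF Px; apply: down.
  by move: pxs; rewrite path_sortedE // => /andP[/allP/(_ _ sy)].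
rewrite path_sortedE // in pxs; congr cons; apply/esym/all_filterP/allP=> y sy /=.
by apply: contraFN Px; apply: down; case/andP: pxs => /allP/(_ _ sy).
Qed.

Lemma sorted_by_row_split i s : sorted by_row s ->
  s = [seq p <- s | i.+1 < p.1] ++ [seq p <- s | p.1 == i.+1] ++
      [seq p <- s | p.1 == i] ++ [seq p <- s | p.1 < i].
Proof.
move=> ss; have split_at j t : sorted by_row t ->
    t = [seq p <- t | j <= p.1] ++ [seq p <- t | p.1 < j].
  move=> st; rewrite {1}(sorted_split (P := fun p => j <= p.1) by_row_trans _ st).
    by congr (_ ++ _); apply: eq_filter => p /=; rewrite ltnNge.
  by move=> [a b] [c d]; rewrite /by_row /=; lia.
have sorted_part P t : sorted by_row t -> sorted by_row (filter P t).
  by apply: sorted_filter; apply: by_row_trans.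
set t1 := [seq p <- s | p.1 < i.+2]; set t2 := [seq p <- t1 | p.1 < i.+1].
transitivity ([seq p <- s | i.+2 <= p.1] ++ [seq p <- t1 | i.+1 <= p.1] ++
              [seq p <- t2 | i <= p.1] ++ [seq p <- t2 | p.1 < i]).
  by rewrite -split_at ?sorted_part // -split_at ?sorted_part // -split_at.
rewrite -!filter_predI.
by congr (_ ++ (_ ++ (_ ++ _))); apply: eq_filter => p /=; lia.
Qed.

Definition letters i (z : seq (nat * nat)) := [seq p.2 | p <- z & p.1 == i].

Lemma letters_cat i s t : letters i (s ++ t) = letters i s ++ letters i t.
Proof. by rewrite /letters filter_cat map_cat. Qed.

Lemma size_letters i z : size (letters i z) = count_mem i (unzip1 z).
Proof. by rewrite size_map size_filter /unzip1 count_map. Qed.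

Lemma sorted_letters i z : sorted by_letter z -> sorted geq (letters i z).
Proof.
move=> sz; rewrite sorted_map.
apply: (@sub_in_sorted _ [pred p | p.1 == i] by_letter); last first.
- by apply: sorted_filter => //; apply: by_letter_trans.
- exact: filter_all.
by move=> [a b] [c d]; rewrite /by_letter !inE /=; lia.
Qed.

Lemma letters_sort_by_row i z : sorted by_letter z ->
  unzip2 [seq p <- sort by_row z | p.1 == i] = rev (letters i z).
Proof.
move=> sz; rewrite (filter_sort by_row_total by_row_trans) -map_rev; congr map.
apply: (sorted_eq by_row_trans by_row_anti); first exact/sort_sorted/by_row_total; last first.
  by rewrite perm_sort perm_sym perm_rev.
rewrite rev_sorted; apply: (@sub_in_sorted _ [pred p | p.1 == i] by_letter); last first.
- by apply: sorted_filter => //; apply: by_letter_trans.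
- exact: filter_all.
by move=> [a b] [c d]; rewrite /by_letter /by_row !inE /=; lia.
Qed.

Lemma word_rows i z : sorted by_letter z ->
  unzip2 (sort by_row z) =
  unzip2 (sort by_row [seq p <- z | i.+1 < p.1]) ++ rev (letters i.+1 z) ++
  rev (letters i z) ++ unzip2 (sort by_row [seq p <- z | p.1 < i]).
Proof.
move=> sz; rewrite {1}(@sorted_by_row_split i (sort by_row z)); last exact/sort_sorted/by_row_total.
rewrite /unzip2 !map_cat -!/(unzip2 _) !letters_sort_by_row //.
by rewrite !(filter_sort by_row_total by_row_trans).
Qed.

Lemma above_rcons R S r s : size R = size S -> above R S -> s < r ->
  above (rcons R r) (rcons S s).
Proof.
elim: R S => [|r' R IH] [|s' S] //= => [_ _ ->//|[eq_sz] /andP[-> a] lt_sr].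
exact: IH.
Qed.

Lemma above_rconsr R S s : above R S -> above R (rcons S s).
Proof. by elim: R S => [|r R IH] [|s' S] //= /andP[-> /IH]. Qed.

Lemma above_rconsl R S r : above R S -> size R < size S -> nth 0 S (size R) < r ->
  above (rcons R r) S.
Proof. by elim: R S => [|r' R IH] [|s S] //= => [_ _ ->|/andP[-> a]] //; apply: IH. Qed.

Section RaiseRow.
Variable i : nat.
Implicit Types z p q : seq (nat * nat).

Lemma above_suffix q : sorted by_letter q -> closes i 0 (unzip1 q) = 0 ->
  size (letters i q) <= size (letters i.+1 q) /\
  above (take (size (letters i q)) (letters i.+1 q)) (letters i q).
Proof.
elim/last_ind: q => // q [w c] IH; rewrite -cats1 sorted_cat_cons => /andP[sq _].
rewrite /unzip1 map_cat -/(unzip1 q) closes_cat closesE !letters_cat => /eqP.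
rewrite addn_eq0 => /andP[/eqP c0 le_o].
have sq' : sorted by_letter q by move: sq; rewrite -cats1 => /cat_sorted2[].
have [le_sz a] := IH sq' c0.
have le_c (p : nat * nat) : p \in q -> by_letter p (w, c).
  by move: sq; rewrite (sorted_pairwise by_letter_trans) pairwise_rcons => /andP[/allP le_q _] /le_q.
case: (eqVneq w i) => [wi|nwi]; last first.
  rewrite (_ : letters i [:: (w, c)] = [::]) ?cats0; last by rewrite /letters /= (negPf nwi).
  by rewrite takel_cat // size_cat; split=> //; apply: leq_trans (leq_addr _ _).
subst w; rewrite (_ : letters i.+1 [:: (i, c)] = [::]) ?cats0; last by rewrite /letters /= ltn_eqF.
have lt_sz : size (letters i q) < size (letters i.+1 q).
  move: le_o (count_opens_closes i (unzip1 q)).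
  by rewrite c0 !size_letters /= /close_step eqxx; lia.
rewrite (_ : letters i [:: (i, c)] = [:: c]); last by rewrite /letters /= eqxx.
rewrite cats1 size_rcons; split=> //.
rewrite (take_nth 0) //; apply: above_rcons => //; first by rewrite size_takel.
have /mapP[[w' c']] := mem_nth 0 lt_sz.
rewrite mem_filter /= => /andP[/eqP-> /le_c] + ->.
by rewrite /by_letter /= ltnn andbF orbF.
Qed.

Lemma above_prefix p : sorted by_letter p -> opens i 0 (unzip1 p) = 0 ->
  above (rev (letters i.+1 p)) (rev (letters i p)).
Proof.
elim: p => // -[w c] p IH sp; rewrite /= opensE => /eqP.
rewrite addn_eq0 => /andP[/eqP o0 le_c0].
have a := IH (path_sorted sp) o0.
have le_c x : x \in p -> by_letter (w, c) x.
  by move: sp; rewrite /= (path_sortedE by_letter_trans) => /andP[/allP le_p _] /le_p.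
rewrite /letters /= -!/(letters _ _).
case: (eqVneq w i) => [wi|nwi].
  by rewrite wi ltn_eqF // rev_cons; apply: above_rconsr.
case: (eqVneq w i.+1) => // wi; rewrite /= rev_cons; subst w.
have lt_sz : size (letters i.+1 p) < size (letters i p).
  move: le_c0 (count_opens_closes i (unzip1 p)).
  by rewrite o0 !size_letters /= /open_step eqxx; lia.
apply: above_rconsl => //; rewrite !size_rev //.
have lt_sz' : size (letters i.+1 p) < size (rev (letters i p)) by rewrite size_rev.
have := mem_nth 0 lt_sz'; rewrite mem_rev => /mapP[[w' c']].
rewrite mem_filter /= => /andP[/eqP-> /le_c] + ->.
by rewrite /by_letter /= ltnn andbF orbF.
Qed.

Lemma plactic_raise_row p q y :
  sorted by_letter (p ++ (i.+1, y) :: q) -> sorted by_letter (p ++ (i, y) :: q) ->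
  opens i 0 (unzip1 p) = 0 -> closes i 0 (unzip1 q) = 0 ->
  plactic (unzip2 (sort by_row (p ++ (i.+1, y) :: q)))
          (unzip2 (sort by_row (p ++ (i, y) :: q))).
Proof.
move=> s1 s0 op cq; rewrite (word_rows i s1) (word_rows i s0).
have nlt : (i.+1 < i) = false by apply/negbTE; rewrite -leqNgt.
rewrite !filter_cat /= !ltnn nlt.
apply: plactic_catl; rewrite [X in plactic X]catA [X in plactic _ X]catA; apply: plactic_catr; rewrite !letters_cat.
have := sorted_letters i.+1 s1; have := sorted_letters i s0.
rewrite !letters_cat /letters /= !eqxx (ltn_eqF (ltnSn i)) (gtn_eqF (ltnSn i)) /= -!/(letters _ _).
move=> sS sR; rewrite !rev_cat !rev_cons -!catA !cat_rcons.
have [sp sq] : sorted by_letter p /\ sorted by_letter q.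
  by move: s1; rewrite -cat1s => /cat_sorted2[-> /cat_sorted2[_ ->]].
have ap := above_prefix sp op; have [le_sz aq] := above_suffix sq cq.
have rev_leq s : sorted geq s -> sorted leq (rev s) by rewrite rev_sorted.
rewrite -(cat_take_drop (size (letters i q)) (letters i.+1 q)) rev_cat -!catA.
move/rev_leq: (sR); rewrite rev_cat rev_cons cat_rcons -{1}(cat_take_drop (size (letters i q)) (letters i.+1 q)) rev_cat -catA => sR'.
apply: plactic_two_rows => //.
- by move/rev_leq: (sS); rewrite rev_cat rev_cons cat_rcons.
- by move: sR'; rewrite !sorted_leq_cat => /and3P[_ /and3P[]].
- move: sS; rewrite (sorted_pairwise (rev_trans leq_trans)) pairwise_cat pairwise_cons.
  by case/and3P=> _ _ /andP[].
- by rewrite size_takel.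
Qed.
End RaiseRow.

Section Compatible.
Variables (n i : nat) (K : seq nat).
Hypothesis lt_in : i.+1 < n.
Hypothesis K_highest : opens i 0 K = 0.
Implicit Types (z p q s : seq (nat * nat)).
Let nSi : (i.+1 == i) = false := gtn_eqF (ltnSn i).
Let niS : (i == i.+1) = false := ltn_eqF (ltnSn i).

Definition flagged (p : nat * nat) := p.2 <= p.1 < n.

Definition row_compatible z :=
  [/\ sorted by_row z, all flagged z & plactic (unzip2 z) K].

Definition letter_compatible z :=
  [/\ sorted by_letter z, all flagged z & plactic (unzip2 (sort by_row z)) K].

Lemma row_letter_compatible z : sorted by_row z ->
  letter_compatible (sort by_letter z) <-> row_compatible z.
Proof.
move=> sz; rewrite /letter_compatible /row_compatible sz sort_sorted; last exact: by_letter_total.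
by rewrite all_sort (sort_by_row_perm (permEl (perm_sort _ _))) sort_by_row_id.
Qed.

Lemma opens_noclose d u : i \notin u -> d <= opens i d u.
Proof.
elim: u d => //= x u IH d; rewrite inE negb_or eq_sym => /andP[/negPf nx nu].
by apply: leq_trans (IH _ nu); rewrite /open_step nx; case: ifP.
Qed.

Lemma sorted_raise p q y : opens i 0 (unzip1 p) = 0 -> closes i 0 (unzip1 q) = 0 ->
  sorted by_letter (p ++ (i.+1, y) :: q) = sorted by_letter (p ++ (i, y) :: q).
Proof.
move=> op cq; rewrite !sorted_cat_cons; congr (_ && _).
  case/lastP: p op => //= p [w c]; rewrite /unzip1 map_rcons -cats1 opens_cat /= => op.
  rewrite -![rcons (rcons _ _) _]cats1 !cat_rcons !sorted_cat_cons /= !andbT; congr (_ && _).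
  by move: op; rewrite /open_step /by_letter /=; case: (eqVneq w i.+1) => // nw _; lia.
case: q cq => //= -[w c] q; rewrite /close_step; case: eqP => // nwi _.
by rewrite /by_letter /=; congr (_ && _); move: nwi => /= nwi; lia.
Qed.

Lemma letter_compatible_raise p q y :
  opens i 0 (unzip1 p) = 0 -> closes i 0 (unzip1 q) = 0 ->
  letter_compatible (p ++ (i.+1, y) :: q) <-> letter_compatible (p ++ (i, y) :: q).
Proof.
move=> op cq; split=> -[sz]; rewrite all_cat /= => /and3P[fp /andP[le_y lt_n] fq] uK.
  have sz' : sorted by_letter (p ++ (i, y) :: q) by rewrite -sorted_raise.
  have uK' := plactic_trans (plactic_sym (plactic_raise_row sz sz' op cq)) uK.
  split=> //; rewrite all_cat /= fp fq /flagged /= (ltnW lt_in) andbT /= leqNgt.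
  (* A letter [i.+1] in row [i] would be an unmatched opening bracket. *)
  apply/negP=> lt_iy; have [+ _] := plactic_promote i 0 uK'; rewrite K_highest.
  have yE : y = i.+1 by move: le_y lt_iy => /=; lia.
  subst y; set s := sort by_row _.
  have ss : sorted by_row s by apply/sort_sorted/by_row_total.
  have fs : all [pred x | (x.1 < i) ==> (x.2 <= x.1)] s.
    rewrite all_sort all_cat /= ltnn /=.
    by apply/andP; split; [move: fp|move: fq]; apply: sub_all => x /andP[le_x _] /=; rewrite le_x implybT.
  have s_y : (i, i.+1) \in s by rewrite mem_sort mem_cat mem_head orbT.
  case/splitPr: s_y ss fs => s1 s2; rewrite sorted_cat_cons => /andP[_].
  rewrite (path_sortedE by_row_trans) all_cat /= => /andP[/allP le_s2 _] /and3P[_ _ /allP f2].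
  suff /opens_noclose : i \notin unzip2 s2.
    move=> /(_ (opens i 0 (unzip2 s1)).+1) lt_o.
    by rewrite /unzip2 map_cat opens_cat /= /open_step eqxx => o0; move: lt_o; rewrite o0.
  apply/mapP=> -[[w c] s2_wc /= cE]; have := le_s2 _ s2_wc; have := f2 _ s2_wc.
  by rewrite /by_row /=; lia.
have sz' : sorted by_letter (p ++ (i.+1, y) :: q) by rewrite sorted_raise.
have uK' := plactic_trans (plactic_raise_row sz' sz op cq) uK.
by split=> //; rewrite all_cat /= fp fq /flagged /= lt_in !andbT; apply: leqW.
Qed.

Definition relabel (f : seq nat -> seq nat) z := zip (f (unzip1 z)) (unzip2 z).

Lemma unzip1_cat p q : unzip1 (p ++ q) = unzip1 p ++ unzip1 q.
Proof. exact: map_cat. Qed.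

Lemma unzip2_cat p q : unzip2 (p ++ q) = unzip2 p ++ unzip2 q.
Proof. exact: map_cat. Qed.

Lemma unzip1_split z u1 x u2 : unzip1 z = u1 ++ x :: u2 -> exists p q y,
  [/\ z = p ++ (x, y) :: q, unzip1 p = u1 & unzip1 q = u2].
Proof.
elim: z u1 => [|[w c] z IH] [|x' u1] //= [-> E]; first by exists [::], z, c.
by have [p [q [y [-> <- <-]]]] := IH _ E; exists ((x', c) :: p), q, y.
Qed.

Lemma zip_unzip_cat p x y q x' :
  zip (unzip1 p ++ x' :: unzip1 q) (unzip2 (p ++ (x, y) :: q)) = p ++ (x', y) :: q.
Proof. by rewrite unzip2_cat zip_cat ?size_map //= !zip_unzip. Qed.

Lemma unzip1_relabel f z : (forall u, size (f u) = size u) ->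
  unzip1 (relabel f z) = f (unzip1 z).
Proof. by move=> sz_f; rewrite unzip1_zip // sz_f !size_map. Qed.

Lemma unzip2_relabel f z : (forall u, size (f u) = size u) ->
  unzip2 (relabel f z) = unzip2 z.
Proof. by move=> sz_f; rewrite unzip2_zip // sz_f !size_map. Qed.

Lemma relabel_raise z : 0 < opens i 0 (unzip1 z) -> exists p q y,
  [/\ z = p ++ (i.+1, y) :: q, relabel (raise i) z = p ++ (i, y) :: q,
      opens i 0 (unzip1 p) = 0 & closes i 0 (unzip1 q) = 0].
Proof.
move/raise_split=> [u1 [u2 [zE rE o1 c2]]].
have [p [q [y [-> pE qE]]]] := unzip1_split zE.
exists p, q, y; split; rewrite ?pE ?qE //.
by rewrite /relabel unzip1_cat /= raise_cat ?pE ?qE // -pE -qE zip_unzip_cat.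
Qed.

Lemma relabel_raise_cat p q y : opens i 0 (unzip1 p) = 0 -> closes i 0 (unzip1 q) = 0 ->
  relabel (raise i) (p ++ (i.+1, y) :: q) = p ++ (i, y) :: q.
Proof. by move=> op cq; rewrite /relabel unzip1_cat /= raise_cat // zip_unzip_cat. Qed.

Lemma relabel_demote_closure (P : seq (nat * nat) -> Prop) z :
  (forall p q y, opens i 0 (unzip1 p) = 0 -> closes i 0 (unzip1 q) = 0 ->
     P (p ++ (i.+1, y) :: q) -> P (p ++ (i, y) :: q)) ->
  P z -> P (relabel (demote i 0) z).
Proof.
move=> step Pz.
apply: proj2 (demote_closure (P := fun h => size h = size z /\ P (zip h (unzip2 z))) _ _); last first.
  by rewrite zip_unzip size_map.
move=> u1 u2 o1 c2 [sz]; set z' := zip _ _.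
have z1 : unzip1 z' = u1 ++ i.+1 :: u2 by rewrite unzip1_zip // sz size_map.
have <- : unzip2 z' = unzip2 z by rewrite unzip2_zip // sz size_map.
have [p [q [y [-> pE qE]]]] := unzip1_split z1.
rewrite -pE -qE zip_unzip_cat pE qE; split; first by rewrite -sz !size_cat.
by apply: step; rewrite ?pE ?qE.
Qed.

Lemma relabel_promote_closure (P : seq (nat * nat) -> Prop) z :
  (forall p q y, opens i 0 (unzip1 p) = 0 -> closes i 0 (unzip1 q) = 0 ->
     P (p ++ (i, y) :: q) -> P (p ++ (i.+1, y) :: q)) ->
  P z -> P (relabel (promote i 0) z).
Proof.
move=> step Pz.
apply: proj2 (promote_closure (P := fun h => size h = size z /\ P (zip h (unzip2 z))) _ _); last first.
  by rewrite zip_unzip size_map.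
move=> u1 u2 o1 c2 [sz]; set z' := zip _ _.
have z1 : unzip1 z' = u1 ++ i :: u2 by rewrite unzip1_zip // sz size_map.
have <- : unzip2 z' = unzip2 z by rewrite unzip2_zip // sz size_map.
have [p [q [y [-> pE qE]]]] := unzip1_split z1.
rewrite -pE -qE zip_unzip_cat pE qE; split; first by rewrite -sz !size_cat.
by apply: step; rewrite ?pE ?qE.
Qed.

Lemma letter_compatible_demote z : letter_compatible z -> letter_compatible (relabel (demote i 0) z).
Proof. by apply: relabel_demote_closure => p q y op cq /letter_compatible_raise; apply. Qed.

Lemma letter_compatible_promote z : letter_compatible z -> letter_compatible (relabel (promote i 0) z).
Proof. by apply: relabel_promote_closure => p q y op cq /letter_compatible_raise; apply. Qed.

(* These biwords come from the composition with [a_i] and [a_(i+1)] exchanged.  *)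
(* On each raising string they are all its elements, or just the one without    *)
(* unmatched closing brackets.                                                  *)
Definition promote_flagged z :=
  all flagged (zip (unzip1 (sort by_row z)) (promote i 0 (unzip2 (sort by_row z)))).

Lemma promote_flagged_rows s d : all flagged s -> all (fun x : nat * nat => x.1 != i) s ->
  all flagged (zip (unzip1 s) (promote i d (unzip2 s))).
Proof.
elim: s d => //= -[w c] s IH d /andP[f_wc fs] /andP[/= nwi ns]; rewrite IH // andbT.
by move: f_wc; rewrite /flagged /=; case: ifP => [/andP[/eqP ciE _]|_] /=; lia.
Qed.

Lemma promote_flagged_row s d : all flagged s -> all (fun x : nat * nat => x.1 == i) s ->
  all flagged (zip (unzip1 s) (promote i d (unzip2 s))) = (count_mem i (unzip2 s) <= d).
Proof.
elim: s d => //= -[w c] s IH d /andP[f_wc fs] /andP[/= /eqP wi ns]; subst w.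
rewrite IH // /open_step; move: f_wc; rewrite /flagged /= => f_wc.
rewrite (_ : (c == i.+1) = false); last by lia.
by case: eqP => [cE|_]; case: d {IH} => [|d] /=; rewrite ?addn0 ?add0n; lia.
Qed.

Lemma opens_row u d : sorted leq u -> all (geq i.+1) u ->
  opens i d u = d - count_mem i u + count_mem i.+1 u.
Proof.
elim: u d => [|x u IH] d /=; first by lia.
rewrite (path_sortedE leq_trans) => /andP[/allP le_x su] /andP[lt_x lt_u].
rewrite IH // /open_step; case: (eqVneq x i.+1) => [xE|_]; last by case: eqP => _ /=; lia.
have -> : count_mem i u = 0.
  by apply/count_memPn/negP=> /le_x; rewrite xE ltnn.
by rewrite xE nSi /= ?add0n subn0; lia.
Qed.

(* The number of brackets open when the lower word reaches row [i]. *)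
Definition matched z :=
  opens i 0 (unzip2 (sort by_row [seq p <- z | i.+1 < p.1])) -
    count_mem (i.+1, i) z + count_mem (i.+1, i.+1) z.

Lemma count_letters w c z : count_mem c (letters w z) = count_mem (w, c) z.
Proof.
rewrite count_map count_filter; apply: eq_count => -[w' c'] /=.
by rewrite xpair_eqE andbC.
Qed.

Lemma letters_le w z : all flagged z -> all (geq w) (letters w z).
Proof.
move=> /allP fz; apply/allP=> _ /mapP[[w' c] + ->]; rewrite mem_filter => /andP[/eqP<- /fz].
by case/andP.
Qed.

Lemma opens_small d u : all (gtn i) u -> opens i d u = d.
Proof.
elim: u d => //= x u IH d /andP[lt_xi lt_u]; rewrite IH // /open_step.
by case: eqP => [xE|_]; last case: eqP; lia.
Qed.

Lemma promote_flagged_cat s t d :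
  all flagged (zip (unzip1 (s ++ t)) (promote i d (unzip2 (s ++ t)))) =
  all flagged (zip (unzip1 s) (promote i d (unzip2 s))) &&
  all flagged (zip (unzip1 t) (promote i (opens i d (unzip2 s)) (unzip2 t))).
Proof. by rewrite unzip1_cat unzip2_cat promote_cat zip_cat ?all_cat // size_promote !size_map. Qed.

Lemma matchedP z : letter_compatible z ->
  matched z <= count_mem (i, i) z /\
  promote_flagged z = (count_mem (i, i) z <= matched z).
Proof.
move=> [sz fz uK].
have sorted_row w : sorted leq (rev (letters w z)) by rewrite rev_sorted sorted_letters.
have opens_rows : opens i 0 (unzip2 (sort by_row [seq p <- z | i.+1 < p.1]) ++
    rev (letters i.+1 z)) = matched z.
  rewrite opens_cat opens_row ?all_rev ?letters_le //.
  by rewrite !count_rev !count_letters.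
split.
  have [+ _] := plactic_promote i 0 uK; rewrite K_highest (word_rows i) // catA opens_cat opens_rows.
  rewrite opens_cat opens_small; last first.
    apply/allP=> _ /mapP[[w c] + ->]; rewrite mem_sort mem_filter /= => /andP[lt_wi /(allP fz)].
    by case/andP=> /= le_cw _; apply: leq_ltn_trans lt_wi.
  rewrite opens_row ?all_rev //; last first.
    by apply: (sub_all _ (letters_le i fz)) => x /= le_x; apply: leqW.
  rewrite !count_rev (_ : count_mem i.+1 _ = 0); last first.
    by apply/count_memPn/negP=> /(allP (letters_le i fz)); rewrite /= ltnn.
  by rewrite addn0 count_letters => /eqP; rewrite subn_eq0.
have fs : all flagged (sort by_row z) by rewrite all_sort.
have fP (P : pred (nat * nat)) : all flagged (filter P (sort by_row z)).
  by apply/allP=> x; rewrite mem_filter => /andP[_ /(allP fs)].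
have rowE w : unzip2 [seq p <- sort by_row z | p.1 == w] = rev (letters w z).
  exact: letters_sort_by_row.
have sE := @sorted_by_row_split i (sort by_row z) (sort_sorted by_row_total z).
have other (P : pred (nat * nat)) : (forall x, P x -> x.1 != i) ->
    all (fun x : nat * nat => x.1 != i) (filter P (sort by_row z)).
  by move=> nP; apply/allP=> x; rewrite mem_filter => /andP[/nP].
rewrite /promote_flagged {1 2}sE !promote_flagged_cat.
rewrite (promote_flagged_rows _ (fP _) (other (fun x => i.+1 < x.1) _)); last by move=> x; lia.
rewrite (promote_flagged_rows _ (fP _) (other (fun x => x.1 == i.+1) _)); last by move=> x; lia.
rewrite (promote_flagged_rows _ (fP _) (other (fun x => x.1 < i) _)) ?andbT; last by move=> x; lia.
rewrite (promote_flagged_row _ (fP _) (filter_all _ _)) -opens_cat !rowE count_rev count_letters.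
by rewrite (filter_sort by_row_total by_row_trans) opens_rows.
Qed.

Lemma closes_ge z : sorted by_letter z -> all flagged z ->
  count_mem (i, i) z <= closes i 0 (unzip1 z) + count_mem (i.+1, i.+1) z.
Proof.
elim: z => //= -[w c] z IH; rewrite (path_sortedE by_letter_trans) => /andP[/allP le_z sz].
case/andP=> /= /andP[/= le_cw _] fz; have {IH} := IH sz fz.
rewrite !xpair_eqE /close_step.
case: (eqVneq w i) => [wi|nwi] /=; first by rewrite wi niS /=; case: (c == i); lia.
case: (eqVneq w i.+1) => [wi|nwi1] /=; last by lia.
case: (eqVneq c i.+1) => [cE|nc] /=; first by lia.
rewrite (_ : count_mem (i, i) z = 0) //; apply/count_memPn/negP=> /le_z.
by rewrite /by_letter /=; lia.
Qed.

Lemma closes_le z : sorted by_letter z -> all flagged z -> all (fun x : nat * nat => i <= x.2) z ->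
  closes i 0 (unzip1 z) <= count_mem (i, i) z - count_mem (i.+1, i.+1) z.
Proof.
elim: z => //= -[w c] z IH; rewrite (path_sortedE by_letter_trans) => /andP[/allP le_z sz].
case/andP=> /= /andP[/= le_cw _] fz /andP[le_ic lz]; have {IH} := IH sz fz lz.
rewrite !xpair_eqE /close_step.
case: (eqVneq w i) => [wi|nwi] /=.
  have ci : c = i by lia.
  rewrite ci wi !eqxx !niS /= (_ : count_mem (i.+1, i.+1) z = 0); first by lia.
  by apply/count_memPn/negP=> /le_z; rewrite /by_letter /=; lia.
case: (eqVneq w i.+1) => [wi|nwi1] /=; last by lia.
by case: (eqVneq c i.+1) => [cE|nc] /=; lia.
Qed.

Lemma demote_entries z : letter_compatible z -> let z' := relabel (demote i 0) z in
  [/\ [seq p <- z' | i.+1 < p.1] = [seq p <- z | i.+1 < p.1],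
      count_mem (i, i) z' + count_mem (i.+1, i) z' =
        count_mem (i, i) z + count_mem (i.+1, i) z,
      count_mem (i.+1, i.+1) z' = count_mem (i.+1, i.+1) z,
      count_mem (i, i) z <= count_mem (i, i) z' &
      0 < closes i 0 (unzip1 z) -> count_mem (i, i) z = count_mem (i.+1, i.+1) z ->
      count_mem (i, i) z' = count_mem (i, i) z].
Proof.
move=> Cz z'.
pose P t := [/\ letter_compatible t,
  closes i 0 (unzip1 z) <= closes i 0 (unzip1 t) &
  [/\ [seq p <- t | i.+1 < p.1] = [seq p <- z | i.+1 < p.1],
      count_mem (i, i) t + count_mem (i.+1, i) t =
        count_mem (i, i) z + count_mem (i.+1, i) z,
      count_mem (i.+1, i.+1) t = count_mem (i.+1, i.+1) z,
      count_mem (i, i) z <= count_mem (i, i) t &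
      0 < closes i 0 (unzip1 z) -> count_mem (i, i) z = count_mem (i.+1, i.+1) z ->
      count_mem (i, i) t = count_mem (i, i) z]].
suff [] : P z' by [].
apply: (relabel_demote_closure (P := P)) => // p q y op cq [Ct le_cl [E1 E2 E3 E4 E5]].
have Ct' := (letter_compatible_raise y op cq).1 Ct; have [_ ft' _] := Ct'.
have le_yi : y <= i by move: ft'; rewrite all_cat /= => /and3P[_ /andP[]].
have nlt : (i.+1 < i) = false by apply/negbTE; rewrite -leqNgt.
have cl_p : closes i 0 (unzip1 (p ++ (i.+1, y) :: q)) = closes i 0 (unzip1 p).
  by rewrite unzip1_cat closes_cat /= cq /close_step nSi eqxx.
split=> //.
  apply: leq_trans le_cl _; rewrite !unzip1_cat /= closes_raise //.
split.
- by move: E1; rewrite !filter_cat /= ltnn nlt.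
- by move: E2; rewrite !count_cat /= !xpair_eqE !eqxx niS nSi /=; lia.
- by move: E3; rewrite !count_cat /= !xpair_eqE !eqxx niS /= (_ : (y == i.+1) = false) //; lia.
- by move: E4; rewrite !count_cat /= !xpair_eqE !eqxx nSi /=; lia.
move=> cl_z rq; have := E5 cl_z rq; rewrite !count_cat /= !xpair_eqE !eqxx nSi /=.
case: (eqVneq y i) => [yi|_] //=; rewrite !add0n => rE; subst y; exfalso.
have [st ft _] := Ct; move: (st) (ft); rewrite (sorted_pairwise by_letter_trans) pairwise_cat.
rewrite all_cat /= => /and3P[/allrelP le_pq _ /andP[/allP le_q _]] /and3P[fp _ fq].
have sp : sorted by_letter p by move: st => /cat_sorted2[].
have le_p : all (fun x : nat * nat => i <= x.2) p.
  by apply/allP=> -[w c] /le_pq/(_ (mem_head _ _)); rewrite /by_letter /=; lia.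
have cq0 : count_mem (i.+1, i.+1) q = 0.
  by apply/count_memPn/negP=> /le_q; rewrite /by_letter /=; lia.
have qE : count_mem (i.+1, i.+1) p = count_mem (i, i) z.
  by rewrite rq -E3 count_cat /= xpair_eqE niS andbF cq0 !addn0.
have := leq_trans cl_z (leq_trans le_cl _); rewrite cl_p => /(_ _ (closes_le sp fp le_p)).
by rewrite qE subn_gt0 -rE ltnNge leq_addr.
Qed.

Lemma promote_flagged_closes0 z : letter_compatible z -> closes i 0 (unzip1 z) = 0 -> promote_flagged z.
Proof.
move=> Cz cl0; have [le_m ->] := matchedP Cz; have [sz fz _] := Cz.
by have := closes_ge sz fz; move: le_m; rewrite /matched cl0; lia.
Qed.

Lemma promote_flagged_demote z : letter_compatible z -> 0 < closes i 0 (unzip1 z) ->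
  promote_flagged (relabel (demote i 0) z) = promote_flagged z.
Proof.
move=> Cz cl; have Cz' := letter_compatible_demote Cz.
have [le_m ->] := matchedP Cz; have [le_m' ->] := matchedP Cz'.
have [E1 E2 E3 le_r /(_ cl) E5] := demote_entries Cz.
move: le_m le_m'; rewrite /matched E1 E3.
by move=> le_m le_m'; apply/idP/idP; lia.
Qed.
End Compatible.

(** * Strings and the Demazure recursion *)

Section Recolor.
Variables (n i : nat) (K : seq nat).
Hypothesis lt_in : i.+1 < n.
Hypothesis K_highest : opens i 0 K = 0.
Implicit Types (s : seq (nat * nat)).

Definition recolor (f : seq nat -> seq nat) s := zip (unzip1 s) (f (unzip2 s)).

Lemma sorted_promote d s : sorted by_row s -> sorted by_row (recolor (promote i d) s).
Proof.
rewrite /recolor; case: s => //= -[w c] s /=.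
elim: s w c d => //= -[w' c'] s IH w c d /andP[le_cc' ps]; rewrite IH // andbT.
move: le_cc'; rewrite /by_row /open_step /=.
case: (eqVneq c i.+1) => [cE|_]; last case: (eqVneq c i) => [cE|_].
- by rewrite cE (gtn_eqF (ltnSn i)) /= andbF; lia.
- by case: d => [|d] /=; case: (eqVneq c' i) => [cE'|nc'] /=; try case: ifP => _; lia.
- by case: (eqVneq c' i) => [cE'|nc'] /=; try case: ifP => _; lia.
Qed.

Lemma sorted_demote e s : sorted by_row s -> sorted by_row (recolor (demote i e) s).
Proof.
rewrite /recolor; case: s => //= -[w c] s /=.
elim: s w c => //= -[w' c'] s IH w c /andP[le_cc' ps]; rewrite IH // andbT.
move: le_cc'; rewrite /by_row /close_step /=; case: (closes i e (unzip2 s)) => [|k].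
all: case: (eqVneq c' i.+1) => [->|nc'] /=; rewrite ?(gtn_eqF (ltnSn i)) /=.
all: try (case: (eqVneq c' i) => [->|nci] /=).
all: case: (eqVneq c i.+1) => [->|nc] /=; try case: ifP => _; lia.
Qed.

Lemma unzip1_recolor f s : size (f (unzip2 s)) = size s -> unzip1 (recolor f s) = unzip1 s.
Proof. by move=> sz_f; rewrite unzip1_zip // sz_f size_map. Qed.

Lemma unzip2_recolor f s : size (f (unzip2 s)) = size s -> unzip2 (recolor f s) = f (unzip2 s).
Proof. by move=> sz_f; rewrite unzip2_zip // sz_f size_map. Qed.

Lemma flagged_demote s : all (flagged n) s -> all (flagged n) (recolor (demote i 0) s).
Proof.
rewrite /recolor; elim: s => //= -[w c] s IH /andP[fx fs]; rewrite IH // andbT.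
by move: fx; rewrite /flagged /=; case: ifP => //; lia.
Qed.

Lemma row_compatible_promote s : row_compatible n K s ->
  all (flagged n) (recolor (promote i 0) s) -> row_compatible n (promote i 0 K) (recolor (promote i 0) s).
Proof.
move=> [ss fs sK] fs'; split=> //; first exact: sorted_promote.
by rewrite unzip2_recolor ?size_promote ?size_map //; have [] := plactic_promote i 0 sK.
Qed.

Lemma row_compatible_demote s : row_compatible n (promote i 0 K) s ->
  row_compatible n K (recolor (demote i 0) s) /\ recolor (promote i 0) (recolor (demote i 0) s) = s.
Proof.
move=> [ss fs sK]; have [cl pl] := plactic_demote i 0 sK.
rewrite closes_promote in cl; rewrite promote0K // in pl.
have szd : size (demote i 0 (unzip2 s)) = size s by rewrite size_demote size_map.
split; first by split; rewrite ?unzip2_recolor //; [apply: sorted_demote | apply: flagged_demote].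
by rewrite {1}/recolor unzip1_recolor // unzip2_recolor // demote0K // zip_unzip.
Qed.

Lemma recolor_promote_inj s t : row_compatible n K s -> row_compatible n K t ->
  recolor (promote i 0) s = recolor (promote i 0) t -> s = t.
Proof.
move=> [_ _ sK] [_ _ tK] E.
have [os _] := plactic_promote i 0 sK; have [ot _] := plactic_promote i 0 tK.
rewrite K_highest in os ot.
rewrite -(zip_unzip s) -(zip_unzip t) -(promote0K os) -(promote0K ot).
have sz (v : seq (nat * nat)) : size (promote i 0 (unzip2 v)) = size v by rewrite size_promote size_map.
by rewrite -(unzip2_recolor (sz s)) -(unzip1_recolor (sz s)) E unzip2_recolor // unzip1_recolor.
Qed.

End Recolor.

Lemma big_seq_bij (R : nmodType) (S T : eqType) (L : seq S) (M : seq T)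
    (P : pred S) (Q : pred T) (f : S -> T) (F : T -> R) :
  uniq L -> uniq M ->
  {in [pred x | (x \in L) && P x] &, injective f} ->
  (forall x, x \in L -> P x -> (f x \in M) && Q (f x)) ->
  (forall y, y \in M -> Q y -> exists x, [/\ x \in L, P x & y = f x]) ->
  (\sum_(y <- M | Q y) F y = \sum_(x <- L | P x) F (f x))%R.
Proof.
move=> uL uM inj_f fM surj_f; rewrite -big_filter -[RHS]big_filter -(big_map f xpredT F).
apply: perm_big; apply: uniq_perm; first exact: filter_uniq.
  rewrite map_inj_in_uniq ?filter_uniq // => x y.
  by rewrite !mem_filter ![P _ && _]andbC; apply: inj_f.
move=> y; apply/idP/mapP => [|[x]]; rewrite mem_filter.
  case/andP=> Qy My; have [x [Lx Px ->]] := surj_f y My Qy.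
  by exists x => //; rewrite mem_filter Px.
by case/andP=> Px Lx ->; rewrite mem_filter andbC; apply: fM.
Qed.

Section Strings.
Implicit Types z : seq (nat * nat).
Variables (n i : nat) (K : seq nat).
Hypothesis lt_in : i.+1 < n.
Hypothesis K_highest : opens i 0 K = 0.
Local Open Scope ring_scope.
Variables (R : idomainType) (wt : seq nat -> R) (x0 x1 : R) (sg : {rmorphism R -> R}).
Hypothesis wt_raise : forall u v, wt (u ++ i :: v) * x1 = wt (u ++ i.+1 :: v) * x0.
Hypothesis wt_swap : forall u v,
  (forall k, count_mem k v = count_mem (swap i k) u) -> sg (wt u) = wt v.
Hypotheses (sg0 : sg x0 = x1) (sg1 : sg x1 = x0) (x1_neq_x0 : x1 != x0).
Variable L : seq (seq (nat * nat)).
Hypothesis uL : uniq L.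
Hypothesis memL : forall z, z \in L <-> letter_compatible n K z.
Let cl (z : seq (nat * nat)) := closes i 0 (unzip1 z).
Let op (z : seq (nat * nat)) := opens i 0 (unzip1 z).
Let bottom z := relabel (demote i 0) z.

Lemma bottom_raise z : (0 < op z)%N -> bottom (relabel (raise i) z) = bottom z.
Proof.
move/relabel_raise=> [p [q [y [-> -> o c]]]]; rewrite /bottom /relabel.
by rewrite !unzip1_cat !unzip2_cat /= demote_raise.
Qed.

Lemma bottom_bottom z : bottom (bottom z) = bottom z.
Proof.
rewrite /bottom {1}/relabel unzip1_relabel ?unzip2_relabel; try exact: size_demote.
by rewrite demote_id ?opens_demote.
Qed.

Section StringClass.
Variable g : pred (seq (nat * nat)).
Hypothesis g_bottom : forall z, g (bottom z) = g z.

Lemma sum_raise :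
  x0 * (\sum_(z <- L | g z && (0 < op z)%N) wt (unzip1 z)) =
  x1 * (\sum_(z <- L | g z && (0 < cl z)%N) wt (unzip1 z)).
Proof.
rewrite [X in _ = _ * X](@big_seq_bij _ _ _ L L (fun z => g z && (0 < op z)%N) _ (relabel (raise i))) //.
- rewrite !mulr_sumr; apply: eq_bigr => z /andP[_ /relabel_raise[p [q [y [-> -> _ _]]]]].
  by rewrite !unzip1_cat /= mulrC -wt_raise mulrC.
- move=> z t; rewrite !inE => /andP[_ /andP[_ oz]] /andP[_ /andP[_ ot]] E.
  have := congr1 unzip1 E; have := congr1 unzip2 E.
  rewrite !unzip1_relabel ?unzip2_relabel; try exact: size_raise.
  move=> E2 /(raise_inj oz ot) E1.
  by rewrite -(zip_unzip z) -(zip_unzip t) E1 E2.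
- move=> z /memL Cz /andP[gz oz].
  rewrite -g_bottom bottom_raise // g_bottom gz /=.
  have [p [q [y [zE -> o c]]]] := relabel_raise oz; rewrite zE in Cz.
  have -> /= : p ++ (i, y) :: q \in L by apply/memL/letter_compatible_raise.
  by rewrite /cl unzip1_cat /= closes_raise.
- move=> z /memL Cz /andP[gz cz].
  have [u1 [u2 [zE o c]]] := unraise_split cz.
  have [p [q [y [zE' pE qE]]]] := unzip1_split zE.
  rewrite -pE -qE in o c; exists (p ++ (i.+1, y) :: q).
  rewrite relabel_raise_cat // zE'; rewrite zE' in Cz gz.
  have oz : (0 < op (p ++ (i.+1, y) :: q))%N by rewrite /op unzip1_cat /= opens_raise.
  split=> //; first by apply/memL/letter_compatible_raise.
  by rewrite oz andbT -g_bottom -bottom_raise // relabel_raise_cat // g_bottom.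
Qed.

Lemma sum_string :
  (x1 - x0) * (\sum_(z <- L | g z) wt (unzip1 z)) =
  x1 * (\sum_(z <- L | g z && (cl z == 0)%N) wt (unzip1 z)) -
  x0 * (\sum_(z <- L | g z && (op z == 0)%N) wt (unzip1 z)).
Proof.
rewrite mulrBl {1}(bigID (fun z => cl z == 0)%N) [X in _ - x0 * X](bigID (fun z => op z == 0)%N) /=.
rewrite !mulrDr -!(eq_bigl _ _ (fun z => congr1 (andb (g z)) (lt0n _))) sum_raise.
by rewrite opprD addrACA subrr addr0.
Qed.

Lemma sum_string_ends :
  sg (\sum_(z <- L | g z && (cl z == 0)%N) wt (unzip1 z)) =
  \sum_(z <- L | g z && (op z == 0)%N) wt (unzip1 z).
Proof.
rewrite [RHS](@big_seq_bij _ _ _ L L (fun z => g z && (cl z == 0)%N) _ bottom) //.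
- rewrite rmorph_sum; apply: eq_bigr => z /andP[_ /eqP cz]; apply: wt_swap => k.
  by rewrite /bottom unzip1_relabel ?count_demote //; apply: size_demote.
- move=> z t; rewrite !inE => /andP[_ /andP[_ /eqP cz]] /andP[_ /andP[_ /eqP ct]] E.
  have := congr1 unzip1 E; have := congr1 unzip2 E.
  rewrite /bottom !unzip1_relabel ?unzip2_relabel; try exact: size_demote.
  move=> E2 E1; rewrite -(zip_unzip z) -(zip_unzip t) E2.
  by rewrite -[unzip1 z](demote0K cz) -[unzip1 t](demote0K ct) E1.
- move=> z /memL Cz /andP[gz cz]; rewrite g_bottom gz /= /op unzip1_relabel; last exact: size_demote.
  by rewrite opens_demote andbT; apply/memL/letter_compatible_demote.
- move=> z /memL Cz /andP[gz /eqP oz]; exists (relabel (promote i 0) z).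
  have bE : bottom (relabel (promote i 0) z) = z.
    rewrite /bottom {1}/relabel unzip1_relabel ?unzip2_relabel; try exact: size_promote.
    by rewrite promote0K // zip_unzip.
  split=> //; first exact/memL/letter_compatible_promote.
  rewrite -g_bottom bE gz /cl unzip1_relabel ?closes_promote //; exact: size_promote.
Qed.

End StringClass.

Let free z := promote_flagged n i z.
Let inner z := free (bottom z).

Lemma free_inner z : letter_compatible n K z -> free z = inner z || (cl z == 0)%N.
Proof.
move=> Cz; have [c0|c_gt0] := posnP (cl z); first by rewrite orbT; apply: (promote_flagged_closes0 lt_in K_highest Cz).
by rewrite /inner /free (promote_flagged_demote lt_in K_highest Cz) // orbF.
Qed.

Lemma sum_strings :
  (x1 - x0) * (\sum_(z <- L) wt (unzip1 z)) =
  x1 * (\sum_(z <- L | free z) wt (unzip1 z)) -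
  x0 * sg (\sum_(z <- L | free z) wt (unzip1 z)).
Proof.
have inner_bottom z : inner (bottom z) = inner z by rewrite /inner bottom_bottom.
have outer_bottom z : ~~ inner (bottom z) = ~~ inner z by rewrite inner_bottom.
have inner_sg : sg (\sum_(z <- L | inner z) wt (unzip1 z)) = \sum_(z <- L | inner z) wt (unzip1 z).
  have := sum_string inner_bottom; rewrite -(sum_string_ends inner_bottom).
  set S := \sum_(z <- L | inner z) _; set T := \sum_(z <- L | _) _ => E.
  have ssT : sg (sg T) = T.
    rewrite !rmorph_sum; apply: eq_bigr => z _.
    have swapK : involutive (swap i).
      move=> k; rewrite /swap; case: (eqVneq k i) => [->|ki]; first by rewrite gtn_eqF // eqxx.
      by case: (eqVneq k i.+1) => [->|kS]; rewrite ?eqxx // (negPf ki) (negPf kS).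
    rewrite (wt_swap (v := map (swap i) (unzip1 z))); last first.
      by move=> k; rewrite [LHS]count_map; apply: eq_count => x /=; rewrite (can2_eq swapK swapK).
    apply: wt_swap => k; rewrite [RHS]count_map; apply: eq_count => x /=.
    by rewrite (inj_eq (can_inj swapK)).
  have := congr1 sg E; rewrite !rmorphB !rmorphM !rmorphB /= sg0 sg1 ssT => E'.
  apply: (@mulfI _ (x1 - x0)); first by rewrite subr_eq0.
  by rewrite E -opprB mulNr E' opprB.
have -> : \sum_(z <- L | free z) wt (unzip1 z) = \sum_(z <- L | inner z) wt (unzip1 z) +
    \sum_(z <- L | ~~ inner z && (cl z == 0)%N) wt (unzip1 z).
  rewrite (bigID inner) /=; congr (_ + _); rewrite big_seq_cond [RHS]big_seq_cond;
    apply: eq_bigl => z; case Lz: (z \in L) => //=.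
    by rewrite free_inner; [case: (inner z); rewrite ?andbF | apply/memL].
  by rewrite free_inner; [case: (inner z); rewrite ?andbF ?andbT | apply/memL].
rewrite (bigID inner) /= mulrDr rmorphD /= inner_sg !mulrDr (sum_string outer_bottom).
by rewrite (sum_string_ends outer_bottom) opprD addrACA -mulrBl.
Qed.
End Strings.

Section RowRecurrence.
Variables (n i : nat) (K : seq nat).
Hypothesis lt_in : i.+1 < n.
Hypothesis K_highest : opens i 0 K = 0.
Local Open Scope ring_scope.
Variables (R : idomainType) (wt : seq nat -> R) (x0 x1 : R) (sg : {rmorphism R -> R}).
Hypothesis wt_raise : forall u v, wt (u ++ i :: v) * x1 = wt (u ++ i.+1 :: v) * x0.
Hypothesis wt_swap : forall u v,
  (forall k, count_mem k v = count_mem (swap i k) u) -> sg (wt u) = wt v.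
Hypothesis wt_perm : forall u v, perm_eq u v -> wt u = wt v.
Hypotheses (sg0 : sg x0 = x1) (sg1 : sg x1 = x0) (x1_neq_x0 : x1 != x0).
Variables M M' : seq (seq (nat * nat)).
Hypotheses (uM : uniq M) (uM' : uniq M').
Hypothesis memM : forall z, z \in M <-> row_compatible n K z.
Hypothesis memM' : forall z, z \in M' <-> row_compatible n (promote i 0 K) z.

Lemma row_recurrence :
  (x1 - x0) * (\sum_(z <- M) wt (unzip1 z)) =
  x1 * (\sum_(z <- M') wt (unzip1 z)) - x0 * sg (\sum_(z <- M') wt (unzip1 z)).
Proof.
pose L := map (sort by_letter) M.
have M_sorted s : s \in M -> sorted by_row s by case/memM.
have sortK s : s \in M -> sort by_row (sort by_letter s) = s.
  by move=> Ms; rewrite (sort_by_row_perm (permEl (perm_sort _ _))) sort_by_row_id ?M_sorted.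
have uL : uniq L.
  by rewrite map_inj_in_uniq // => s t Ms Mt E; rewrite -(sortK s) // E sortK.
have memL z : z \in L <-> letter_compatible n K z.
  split=> [/mapP[s Ms ->]|Cz]; first by apply/row_letter_compatible; [apply: M_sorted | apply/memM].
  have zE : z = sort by_letter (sort by_row z).
    rewrite (sort_by_letter_perm (permEl (perm_sort _ _))) sort_by_letter_id //.
    by case: Cz.
  rewrite zE; apply: map_f; apply/memM/row_letter_compatible; last by rewrite -zE.
  exact/sort_sorted/by_row_total.
have sumL P : \sum_(z <- L | P z) wt (unzip1 z) =
    \sum_(s <- M | P (sort by_letter s)) wt (unzip1 s).
  rewrite big_map; apply: eq_bigr => s _; apply: wt_perm.
  by apply: perm_map; rewrite perm_sort.
have := sum_strings lt_in K_highest wt_raise wt_swap sg0 sg1 x1_neq_x0 uL memL.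
rewrite !sumL => ->.
suff -> : \sum_(s <- M | promote_flagged n i (sort by_letter s)) wt (unzip1 s) =
    \sum_(z <- M') wt (unzip1 z) by [].
pose P s := all (flagged n) (recolor (promote i 0) s).
have sz s : size (promote i 0 (unzip2 s)) = size s by rewrite size_promote size_map.
rewrite (@big_seq_bij _ _ _ M M' P xpredT (recolor (promote i 0))) //.
- rewrite big_seq_cond [RHS]big_seq_cond; apply: eq_big => s.
    by case Ms: (s \in M) => //=; rewrite /promote_flagged sortK.
  by rewrite unzip1_recolor.
- move=> s t; rewrite !inE => /andP[Ms _] /andP[Mt _].
  by apply: recolor_promote_inj K_highest _ _ _ _; apply/memM.
- by move=> s Ms Ps; rewrite andbT; apply/memM'/row_compatible_promote => //; apply/memM.
move=> s Ms _; have [C E] := row_compatible_demote lt_in K_highest ((memM' _).1 Ms).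
exists (recolor (demote i 0) s); split=> //; first exact/memM.
by rewrite /P E; case: ((memM' _).1 Ms).
Qed.

End RowRecurrence.

(** * Key words *)

Section KeyWords.
Variable n : nat.
Implicit Types (a : nat -> nat) (D u : seq nat).

Definition key_column a k := rev [seq x <- iota 0 n | k < a x].
Definition key_word r a := flatten [seq key_column a k | k <- iota 0 r].

Lemma bracket_free i u d : (i \notin u) -> (i.+1 \notin u) ->
  [/\ promote i d u = u, opens i d u = d & closes i d u = d].
Proof.
elim: u d => //= x u IH d; rewrite !inE !negb_or ![_ == x]eq_sym.
move=> /andP[/negPf nxi nui] /andP[/negPf nxS nuS].
by have [eu eo ec] := IH d nui nuS; rewrite /open_step /close_step nxi nxS /= eu eo ec.
Qed.

Lemma key_columnE i a k : i.+1 < n -> exists u v,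
  [/\ (i \notin u) && (i.+1 \notin u), (i \notin v) && (i.+1 \notin v) &
    forall b, (forall x, x != i -> x != i.+1 -> b x = a x) ->
    key_column b k = u ++ nseq (k < b i.+1) i.+1 ++ nseq (k < b i) i ++ v].
Proof.
move=> lt_in; exists (rev [seq x <- iota i.+2 (n - i.+2) | k < a x]).
exists (rev [seq x <- iota 0 i | k < a x]); split.
- by rewrite !mem_rev !mem_filter !mem_iota; lia.
- by rewrite !mem_rev !mem_filter !mem_iota; lia.
move=> b ab; rewrite /key_column -{1}(subnKC lt_in) -addn2 -addnA iotaD filter_cat rev_cat.
rewrite add0n iotaD filter_cat rev_cat addn2 /= -catA; congr (_ ++ _).
  congr rev; apply: eq_in_filter => x; rewrite mem_iota => lt_x; rewrite ab //; lia.
rewrite catA; congr (_ ++ _).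
  by do 2!case: ifP => _.
by congr rev; apply: eq_in_filter => x; rewrite mem_iota => lt_x; rewrite ab //; lia.
Qed.

Lemma bracket_key_word i r a : i.+1 < n -> a i.+1 <= a i ->
  opens i 0 (key_word r a) = 0 /\ promote i 0 (key_word r a) = key_word r (a \o swap i).
Proof.
move=> lt_in le_a; rewrite /key_word; elim: (iota 0 r) => //= k s [IHo IHu].
have nSi : (i.+1 == i) = false by rewrite gtn_eqF.
have [u [v [/andP[iu Su] /andP[iv Sv] colE]]] := key_columnE a k lt_in.
have col' : key_column (a \o swap i) k = u ++ nseq (k < a i) i.+1 ++ nseq (k < a i.+1) i ++ v.
  rewrite colE /= /swap ?eqxx ?nSi // => x xi xS.
  by rewrite /= (negPf xi) (negPf xS).
have [uu ou _] := bracket_free 0 iu Su; have [uv ov _] := bracket_free 0 iv Sv.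
have [oc uc] : opens i 0 (key_column a k) = 0 /\ promote i 0 (key_column a k) = key_column (a \o swap i) k.
  rewrite col' colE // !opens_cat !promote_cat ou uu.
  have [lt1|le1] := ltnP k (a i.+1).
    rewrite (leq_trans lt1 le_a) /= /open_step ?eqxx ?nSi /= (ltn_eqF (ltnSn i)) /= ?eqxx /=.
    by rewrite ov uv.
  by case: ltnP => _; rewrite /= /open_step ?eqxx ?(ltn_eqF (ltnSn i)) /= ov uv.
by rewrite opens_cat promote_cat oc uc IHo IHu.
Qed.

Lemma closes_key_word i r a : i.+1 < n -> a i <= a i.+1 -> closes i 0 (key_word r a) = 0.
Proof.
move=> lt_in le_a; rewrite /key_word; elim: (iota 0 r) => //= k s IH.
have nSi : (i.+1 == i) = false by rewrite gtn_eqF.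
have [u [v [/andP[iu Su] /andP[iv Sv] colE]]] := key_columnE a k lt_in.
rewrite closes_cat IH colE // !closes_cat.
have [_ _ ->] := bracket_free 0 iv Sv.
suff -> : closes i (closes i 0 (nseq (k < a i) i)) (nseq (k < a i.+1) i.+1) = 0.
  by have [] := bracket_free 0 iu Su.
have [lt1|le1] := ltnP k (a i).
  by rewrite (leq_trans lt1 le_a) /= /close_step eqxx nSi eqxx.
by case: ltnP; rewrite //= /close_step eqxx nSi.
Qed.

Lemma plactic_column_shift d D z : path gtn d D -> d <= z ->
  plactic (d :: D ++ [:: z]) (d :: z :: D).
Proof.
elim: D d => [|e D IH] d /=; first by move=> *; apply: plactic_refl.
case/andP=> lt_ed pD le_dz.
apply: (@plactic_trans (d :: e :: z :: D)).
  by apply: (plactic_catl [:: d]); apply: IH => //; apply: ltnW (leq_trans lt_ed le_dz).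
exact: (@plactic_yxz [::] D).
Qed.

Lemma plactic_column_block d D m : path gtn d D ->
  plactic (d :: D ++ nseq m d) (nseq m.+1 d ++ D).
Proof.
move=> pD; elim: m => [|m IH]; first by rewrite cats0; apply: plactic_refl.
have := plactic_catr (nseq m d) (plactic_column_shift pD (leqnn d)).
rewrite /= -catA /= => /plactic_trans; apply.
exact: (plactic_catl [:: d] IH).
Qed.

Definition block_word a D := flatten [seq nseq (a x) x | x <- D].

Lemma plactic_column_blocks D a : sorted gtn D ->
  plactic (D ++ block_word a D) (block_word (fun x => (a x).+1) D).
Proof.
elim: D => [|d D IH] /= pD; first exact: plactic_refl.
have := plactic_catr (block_word a D) (plactic_column_block (a d) pD).
rewrite /block_word /= -!catA => /plactic_trans; apply.
exact: (plactic_catl (d :: nseq (a d) d) (IH (path_sorted pD))).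
Qed.

Lemma block_word_filter (P : pred nat) a D : (forall x, x \in D -> ~~ P x -> a x = 0) ->
  block_word a [seq x <- D | P x] = block_word a D.
Proof.
elim: D => //= x D IH a0.
rewrite [RHS]/block_word /= -/(block_word a D) -IH => [|y Dy]; last by apply: a0; rewrite inE Dy orbT.
by case: ifPn => // nPx; rewrite a0 ?mem_head.
Qed.

Lemma plactic_key_word r a : (forall x, x < n -> a x <= r) ->
  plactic (block_word a (rev (iota 0 n))) (key_word r a).
Proof.
elim: r a => [|r IH] a le_ar.
  rewrite /key_word /= /block_word (_ : flatten _ = [::]); first exact: plactic_refl.
  apply/nilP; rewrite /nilp size_flatten sumnE /shape -map_comp big_map big_seq big1 // => x.
  by rewrite mem_rev mem_iota /= size_nseq => /le_ar; rewrite leqn0 => /eqP.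
have colE : key_word r.+1 a = key_column a 0 ++ key_word r (fun x => (a x).-1).
  rewrite /key_word /= (iotaDl 1 0) -map_comp; congr (_ ++ flatten _).
  by apply: eq_map => k /=; congr rev; apply: eq_filter => x; lia.
rewrite colE; have /IH/(plactic_catl (key_column a 0)) : forall x, x < n -> (a x).-1 <= r.
  by move=> x /le_ar; lia.
apply: plactic_trans.
set D := rev (iota 0 n); have DE : key_column a 0 = [seq x <- D | 0 < a x].
  by rewrite /key_column filter_rev.
have sD : sorted gtn (key_column a 0).
  rewrite rev_sorted; apply: sorted_filter; [exact: ltn_trans | exact: iota_ltn_sorted].
have := plactic_column_blocks (fun x => (a x).-1) sD; rewrite {2 3}DE block_word_filter => [pl|x _]; last by lia.
apply: plactic_sym; apply: plactic_trans pl _.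
rewrite (_ : block_word _ _ = block_word a D); first exact: plactic_refl.
rewrite -(@block_word_filter (fun x => 0 < a x) a D) => [|x _]; last by lia.
rewrite /block_word; congr flatten; apply/eq_in_map => x; rewrite mem_filter => /andP[lt _].
by rewrite prednK.
Qed.

End KeyWords.

(** * Words over ordinals *)

Section Interface.
Variable n : nat.

Definition vals (u : seq 'I_n) : seq nat := map val u.

Lemma vals_inj : injective vals.
Proof. exact/inj_map/val_inj. Qed.

Lemma vals_lt (u : seq 'I_n) : all (gtn n) (vals u).
Proof. by apply/allP=> _ /mapP[x _ ->] /=. Qed.

Lemma vals_tuple (v : seq nat) : all (gtn n) v -> exists c : (size v).-tuple 'I_n, vals c = v.
Proof.
elim: v => [|x v IH] /=; first by exists [tuple].
case/andP=> lt_xn /IH[c cE]; exists [tuple of Ordinal lt_xn :: c].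
by rewrite /vals /= -/(vals c) cE.
Qed.

Lemma knuth_step_plactic p (u v : p.-tuple 'I_n) : knuth_step u v -> plactic (vals u) (vals v).
Proof.
case/existsP=> j /and3P[/eqP tE /eqP dE kt].
have split3 (s : seq 'I_n) : s = take j s ++ take 3 (drop j s) ++ drop j.+3 s.
  by rewrite -{1}(cat_take_drop j s) -{1}(cat_take_drop 3 (drop j s)) drop_drop.
rewrite (split3 u) (split3 v) tE dE /vals !map_cat.
move: kt; case: (take 3 _) => [|x1 [|x2 [|x3 []]]] //.
case: (take 3 _) => [|y1 [|y2 [|y3 []]]] //= /orP[].
  by case/and5P=> /eqP-> /eqP-> /eqP-> lt le; apply: plactic_yxz.
by case/and5P=> /eqP-> /eqP-> /eqP-> le lt; apply: plactic_xzy.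
Qed.

Lemma knuth_plactic p (u v : p.-tuple 'I_n) : knuth u v -> plactic (vals u) (vals v).
Proof.
case/connectP=> s; elim: s u => [|w s IH] u /=; first by move=> _ ->; apply: plactic_refl.
case/andP=> st ps vE; apply: plactic_trans (IH _ ps vE).
case/orP: st => /knuth_step_plactic //; exact: plactic_sym.
Qed.

Lemma knuth_stepI p (u v : p.-tuple 'I_n) s x y t : size x = 3 -> size y = 3 ->
  u = s ++ x ++ t :> seq 'I_n -> v = s ++ y ++ t :> seq 'I_n -> knuth_triple x y ->
  knuth_step u v.
Proof.
move=> x3 y3 uE vE kt; have lt_sp : size s < p.
  by rewrite -(size_tuple u) uE !size_cat x3; lia.
have drop3 w : size w = 3 -> drop (size s).+3 (s ++ w ++ t) = t.
  by move=> w3; rewrite catA drop_size_cat // size_cat w3 addn3.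
have take3 w : size w = 3 -> take 3 (drop (size s) (s ++ w ++ t)) = w.
  by move=> w3; rewrite drop_size_cat // take_size_cat.
apply/existsP; exists (Ordinal lt_sp); rewrite /= uE vE !drop3 // !take3 // kt.
by rewrite !take_size_cat // !eqxx.
Qed.

Lemma vals_cat3 (u : seq 'I_n) s x1 x2 x3 t : vals u = s ++ [:: x1; x2; x3] ++ t ->
  exists s' y1 y2 y3 t', [/\ u = s' ++ [:: y1; y2; y3] ++ t', vals s' = s, vals t' = t &
    [/\ val y1 = x1, val y2 = x2 & val y3 = x3]].
Proof.
elim: s u => [|x s IH] [|y1 u] //=.
  case: u => [|y2 [|y3 u]] //= [<- <- <- <-].
  by exists [::], y1, y2, y3, u.
case=> <- /IH[s' [y1' [y2 [y3 [t' [-> <- <- E]]]]]].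
by exists (y1 :: s'), y1', y2, y3, t'.
Qed.

Lemma plactic_knuth p (u v : p.-tuple 'I_n) : plactic (vals u) (vals v) -> knuth u v.
Proof.
have knuthC q : connect_sym (fun u v : q.-tuple 'I_n => knuth_step u v || knuth_step v u).
  by apply: sym_connect_sym => x y; rewrite orbC.
move E1: (vals u) => u1; move E2: (vals v) => v1 uv.
elim: uv p u v E1 E2 => {u1 v1} [w|u1 v1 _ IH|w u1 v1 uw IH1 _ IH2|s t x y z lt le|s t x y z le lt] p u v uE vE.
- have -> : u = v by apply/val_inj/vals_inj; rewrite uE.
  exact: connect0.
- by rewrite /knuth knuthC; apply: IH.
- have sz_w : size w = p.
    by rewrite -(size_tuple u) -(size_map val u) -/(vals u) uE (perm_size (plactic_perm uw)).
  have lt_w : all (gtn n) w by rewrite -(perm_all _ (plactic_perm uw)) -uE vals_lt.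
  have [c cE] := vals_tuple lt_w; subst p.
  by apply: connect_trans (IH1 _ u c uE cE) (IH2 _ c v cE vE).
- have [s' [y1 [y2 [y3 [t' [uE' sE tE [e1 e2 e3]]]]]]] := vals_cat3 uE.
  apply: connect1; apply/orP; left.
  apply: (@knuth_stepI _ u v s' [:: y1; y2; y3] [:: y1; y3; y2] t') => //.
    by apply: vals_inj; rewrite vE /vals !map_cat /= -/(vals s') -/(vals t') sE tE e1 e2 e3.
  by rewrite /= !eqxx e1 e2 e3 lt le.
- have [s' [y1 [y2 [y3 [t' [uE' sE tE [e1 e2 e3]]]]]]] := vals_cat3 uE.
  apply: connect1; apply/orP; left.
  apply: (@knuth_stepI _ u v s' [:: y1; y2; y3] [:: y2; y1; y3] t') => //.
    by apply: vals_inj; rewrite vE /vals !map_cat /= -/(vals s') -/(vals t') sE tE e1 e2 e3.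
  by rewrite /= !eqxx e1 e2 e3 lt le orbT.
Qed.

Lemma nth_flip p (w : p.-tuple 'I_n) j : j < p ->
  nth 0 (vals (flip_word w)) j = n - (nth 0 (vals w) j).+1.
Proof.
move=> lt_jp; rewrite /vals /= -map_comp.
have [x0] : exists x0 : 'I_n, true by exists (tnth w (Ordinal lt_jp)).
by rewrite !(nth_map x0) ?size_tuple.
Qed.

Lemma tnth_vals p (w : p.-tuple 'I_n) (j : 'I_p) : tnth w j = nth 0 (vals w) j :> nat.
Proof. by rewrite (tnth_nth (tnth w j)) /vals (nth_map (tnth w j)) // size_tuple. Qed.

Lemma vals_nth_lt p (w : p.-tuple 'I_n) j : j < p -> nth 0 (vals w) j < n.
Proof. by move=> lt_jp; have := tnth_vals w (Ordinal lt_jp) => /= <-. Qed.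

Definition biword p (cw : p.-tuple 'I_n * p.-tuple 'I_n) :=
  zip (vals (flip_word cw.2)) (vals (flip_word cw.1)).

Lemma compatibleP p (c w : p.-tuple 'I_n) :
  compatible c w = sorted by_row (biword (c, w)) && all (flagged n) (biword (c, w)).
Proof.
have sz (v : p.-tuple 'I_n) : size (vals v) = p by rewrite size_map size_tuple.
have nthE j : j < p -> nth (0, 0) (biword (c, w)) j =
    (n - (nth 0 (vals w) j).+1, n - (nth 0 (vals c) j).+1).
  by move=> lt_jp; rewrite nth_zip ?sz //= !nth_flip.
have szb : size (biword (c, w)) = p by rewrite size_zip !sz minnn.
apply/and3P/andP => [[/forallP le_w /forallP asc /forallP le_wc]|[/(sortedP (0, 0)) sb /(all_nthP (0, 0)) fb]].
  split.
    apply/(sortedP (0, 0)) => j; rewrite szb => lt_jp; rewrite !nthE ?(ltnW lt_jp) //.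
    have := forallP (le_w (Ordinal (ltnW lt_jp))) (Ordinal lt_jp).
    have := forallP (asc (Ordinal (ltnW lt_jp))) (Ordinal lt_jp).
    rewrite !tnth_vals /= eqxx leqnSn /= /by_row /=.
    have := vals_nth_lt w lt_jp; have := vals_nth_lt c lt_jp.
    have := vals_nth_lt w (ltnW lt_jp); have := vals_nth_lt c (ltnW lt_jp).
    by move=> ? ? ? ? /implyP; lia.
  apply/(all_nthP (0, 0)) => j; rewrite szb => lt_jp; rewrite nthE //.
  have := le_wc (Ordinal lt_jp); rewrite !tnth_vals /flagged /=.
  by have := vals_nth_lt w lt_jp; have := vals_nth_lt c lt_jp; lia.
have step j : j.+1 < p -> (nth 0 (vals w) j < nth 0 (vals w) j.+1) ||
    ((nth 0 (vals w) j == nth 0 (vals w) j.+1) && (nth 0 (vals c) j.+1 <= nth 0 (vals c) j)).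
  move=> lt_jp; have := sb j; rewrite szb => /(_ lt_jp); rewrite !nthE ?(ltnW lt_jp) //.
  rewrite /by_row /=.
  have := vals_nth_lt w lt_jp; have := vals_nth_lt c lt_jp.
  by have := vals_nth_lt w (ltnW lt_jp); have := vals_nth_lt c (ltnW lt_jp); lia.
split.
- apply/forallP=> j; apply/forallP=> k; apply/implyP=> le_jk; rewrite !tnth_vals.
  have sw : sorted leq (vals w).
    apply/(sortedP 0) => l; rewrite sz => /step; lia.
  by apply: (sorted_leq_nth leq_trans leqnn _ sw) => //; rewrite inE sz.
- apply/forallP=> j; apply/forallP=> k; apply/implyP=> /eqP kE; apply/implyP.
  have := @step j; rewrite -kE => /(_ (ltn_ord k)); rewrite !tnth_vals kE; lia.
- apply/forallP=> j; rewrite !tnth_vals; have := fb j; rewrite szb nthE // => /(_ (ltn_ord j)).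
  rewrite /flagged /=; have := vals_nth_lt w (ltn_ord j); have := vals_nth_lt c (ltn_ord j); lia.
Qed.

End Interface.

Section Sums.
Variable n : nat.

Definition count_mnm (u : seq nat) : 'X_{1..n} := [multinom count_mem (val (rev_ord k)) u | k < n].
Definition weight u : {mpoly int[n]} := 'X_[count_mnm u].

Definition is_compatible_sum (K : seq nat) (f : {mpoly int[n]}) :=
  exists M, [/\ uniq M, forall z, z \in M <-> row_compatible n K z &
    f = (\sum_(z <- M) weight (unzip1 z))%R].

Lemma compatible_sum_unique K f g :
  is_compatible_sum K f -> is_compatible_sum K g -> f = g.
Proof.
move=> [M [uM memM ->]] [N [uN memN ->]]; apply: perm_big.
by apply: uniq_perm => // z; apply/idP/idP => [/memM/memN|/memN/memM].
Qed.

Lemma flip_wordK p : involutive (@flip_word n p).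
Proof.
move=> w; apply: val_inj; rewrite /= -map_comp -[RHS]map_id; apply: eq_map => x /=.
exact: rev_ordK.
Qed.

Lemma vals_flip_inj p (w w' : p.-tuple 'I_n) :
  vals (flip_word w) = vals (flip_word w') -> w = w'.
Proof. by move=> /vals_inj E; apply: (can_inj (@flip_wordK p)); apply: val_inj. Qed.

Lemma compatible_sum_words p (k : p.-tuple 'I_n) : is_compatible_sum (vals k)
  (\sum_(c : p.-tuple 'I_n | knuth (flip_word c) k)
     \sum_(w : p.-tuple 'I_n | compatible c w) weight (vals (flip_word w)))%R.
Proof.
pose P := [pred cw : p.-tuple 'I_n * p.-tuple 'I_n | knuth (flip_word cw.1) k && compatible cw.1 cw.2].
have sz (v : p.-tuple 'I_n) : size (vals v) = p by rewrite size_map size_tuple.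
have un1 (cw : p.-tuple 'I_n * p.-tuple 'I_n) : unzip1 (biword cw) = vals (flip_word cw.2).
  by rewrite unzip1_zip ?sz.
have un2 (cw : p.-tuple 'I_n * p.-tuple 'I_n) : unzip2 (biword cw) = vals (flip_word cw.1).
  by rewrite unzip2_zip ?sz.
exists [seq biword cw | cw <- enum P]; split.
- rewrite map_inj_uniq ?enum_uniq // => -[c w] [c' w'] E.
  have := un1 (c, w); have := un2 (c, w); rewrite E un1 un2 /=.
  by move=> /vals_flip_inj-> /vals_flip_inj->.
- move=> z; split=> [/mapP[[c w]]|[sz_z fz pz]].
    rewrite mem_enum /= => /andP[/= /knuth_plactic pl]; rewrite compatibleP => /andP[sb fb] ->.
    by split=> //; rewrite un2.
  have sz_z' : size z = p by rewrite -(size_map snd z) (perm_size (plactic_perm pz)) sz.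
  have lt1 : all (gtn n) (unzip1 z) by apply/allP=> _ /mapP[x /(allP fz) /andP[_ ? ->]].
  have lt2 : all (gtn n) (unzip2 z).
    by apply/allP=> _ /mapP[x /(allP fz) /andP[le lt] ->]; apply: leq_ltn_trans lt.
  have [w wE] := vals_tuple lt1; have [c cE] := vals_tuple lt2.
  move: w c wE cE; rewrite !size_map sz_z' => w c wE cE.
  have zE : z = biword (flip_word c, flip_word w).
    by rewrite /biword !flip_wordK wE cE zip_unzip.
  rewrite zE; apply: map_f; rewrite mem_enum inE /= flip_wordK compatibleP -zE sz_z fz !andbT.
  by apply: plactic_knuth; rewrite cE.
rewrite pair_big_dep big_map big_enum /=; apply: eq_big => [[c w]|[c w] _] //.
by rewrite un1.
Qed.

Lemma weight_perm u v : perm_eq u v -> weight u = weight v.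
Proof.
by move=> /seq.permP uv; congr 'X_[_]; apply/mnmP=> k; rewrite !mnmE uv.
Qed.

Lemma msym_var (s : 'S_n) k : msym s 'X_k = 'X_(s k) :> {mpoly int[n]}.
Proof.
rewrite msymX; congr 'X_[_]; apply/mnmP=> l.
by rewrite !mnmE -(inj_eq (@perm_inj _ s)) permKV.
Qed.

Section Step.
Variable i : 'I_n.-1.
Let j := n.-2 - i.
Let lt_in : i < n.-1 := ltn_ord i.

Lemma weight_raise u v :
  (weight (u ++ j :: v) * 'X_(this_pos i) = weight (u ++ j.+1 :: v) * 'X_(next_pos i))%R.
Proof.
rewrite -!mpolyXD; congr 'X_[_]; apply/mnmP=> k; rewrite !mnmE !count_cat /=.
by rewrite -!val_eqE /= /j; move: (ltn_ord k) lt_in; lia.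
Qed.

Lemma weight_swap u v : (forall k, count_mem k v = count_mem (swap j k) u) ->
  msym (simple_tr i) (weight u) = weight v.
Proof.
move=> uv; rewrite msymX; congr 'X_[_]; apply/mnmP=> k; rewrite !mnmE uv; congr count.
congr pred1; rewrite /simple_tr tpermV /swap /=.
have lt_k := ltn_ord k; move: lt_in; rewrite /j.
case: tpermP => [->|->|/eqP+ /eqP+]; rewrite -?val_eqE /=; by do ?[case: eqP]; lia.
Qed.

Lemma next_neq_this : 'X_(this_pos i) != 'X_(next_pos i) :> {mpoly int[n]}.
Proof.
apply/eqP=> /(congr1 (mcoeff U_(this_pos i))); rewrite !mcoeffX eqxx.
case: eqP => [/mnmP/(_ (this_pos i))|_ /eqP]; last by rewrite oner_eq0.
by rewrite !mnm1E eqxx -val_eqE /= gtn_eqF.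
Qed.

Lemma is_compatible_sum_demazure r a f g : a j.+1 <= a j ->
  is_compatible_sum (key_word n r a) f ->
  is_compatible_sum (key_word n r (a \o swap j)) g -> f = demazure i g.
Proof.
move=> le_a [M [uM memM ->]] [M' [uM' memM' ->]].
have lt_jn : j.+1 < n by move: lt_in; rewrite /j; lia.
have [oK uK] := bracket_key_word r lt_jn le_a; rewrite -uK in memM'.
have sg_this : msym (simple_tr i) 'X_(this_pos i) = 'X_(next_pos i) :> {mpoly int[n]}.
  by rewrite msym_var tpermL.
have sg_next : msym (simple_tr i) 'X_(next_pos i) = 'X_(this_pos i) :> {mpoly int[n]}.
  by rewrite msym_var tpermR.
have := row_recurrence lt_jn oK (wt := weight) (sg := msym (simple_tr i)) weight_raise
  weight_swap weight_perm sg_next sg_this next_neq_this uM uM' memM memM'.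
set F := (\sum_(z <- M) _)%R; set G := (\sum_(z <- M') _)%R => E.
apply: (@mulfI _ ('X_(this_pos i) - 'X_(next_pos i))%R); first by rewrite subr_eq0 next_neq_this.
rewrite E /demazure [RHS]mulrC ddiffP msymM sg_this.
by [].
Qed.

End Step.

End Sums.

Section Base.
Variable n : nat.
Implicit Types (a : nat -> nat).

Lemma closes_no_open i u e : i.+1 \notin u -> e <= closes i e u.
Proof.
elim: u => //= x u IH; rewrite inE negb_or eq_sym => /andP[/negPf nx /IH le_e].
by rewrite /close_step nx; case: ifP => // _; apply: leqW.
Qed.

(* An entry [x] below its row [w] needs an earlier [x.+1] to match, which lies   *)
(* in a higher row and hence is itself below its row.                           *)
Lemma diagonal_biword K z : (forall x, x.+1 < n -> closes x 0 K = 0) ->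
  row_compatible n K z -> all (fun p => p.1 == p.2) z.
Proof.
move=> K0 [sz fz pz]; rewrite -[z]cats0; set s := z; set t := [::].
have : s ++ t = z by rewrite cats0.
have -> : all (fun p => p.1 == p.2) (s ++ t) = all (fun p => p.1 == p.2) s by rewrite cats0.
elim/last_ind: s t => // s [w x] IH t; rewrite cat_rcons => zE.
have ds := IH _ zE; rewrite all_rcons ds andbT /=.
have : (w, x) \in z by rewrite -zE mem_cat mem_head orbT.
move=> /(allP fz) /andP[/= le_xw lt_wn]; rewrite eqn_leq le_xw andbT leqNgt; apply/negP=> lt_xw.
have [] := plactic_demote x 0 pz; rewrite K0; last exact: leq_ltn_trans lt_wn.
rewrite -zE unzip2_cat closes_cat /= /close_step eqxx => c0 _.
have [/mapP[[w' x'] s_wx /= x'E]|nSx] := boolP (x.+1 \in unzip2 s); last first.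
  by have := closes_no_open (closes x 0 (unzip2 t)).+1 nSx; rewrite c0.
have /eqP/= w'E := allP ds _ s_wx.
move: sz; rewrite -zE (sorted_pairwise by_row_trans) pairwise_cat.
case/and3P=> /allrelP/(_ _ _ s_wx (mem_head _ _)); rewrite /by_row /= w'E -x'E; lia.
Qed.

Lemma count_block_word a x : x < n -> count_mem x (block_word a (rev (iota 0 n))) = a x.
Proof.
move=> lt_xn; rewrite /block_word count_flatten -map_comp sumnE big_map.
rewrite (perm_big (iota 0 n)) /=; last by rewrite perm_rev.
rewrite (bigD1_seq x) ?iota_uniq ?mem_iota //= big1 => [|y nyx].
  by rewrite count_nseq /= eqxx mul1n addn0.
by rewrite count_nseq /= (negPf nyx).
Qed.

Lemma compatible_sum_base r a : (forall x, x < n -> a x <= r) ->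
  (forall x, x.+1 < n -> a x <= a x.+1) ->
  is_compatible_sum (key_word n r a) (weight n (block_word a (rev (iota 0 n)))).
Proof.
move=> le_ar asc; pose dg (x : nat) := (x, x).
set B := block_word _ _.
have un1 : unzip1 (map dg B) = B by rewrite /unzip1 -map_comp map_id.
have un2 : unzip2 (map dg B) = B by rewrite /unzip2 -map_comp map_id.
have dg_id z : all (fun p : nat * nat => p.1 == p.2) z -> z = map dg (unzip2 z).
  by elim: z => //= -[w c] z IH /andP[/eqP/= -> /IH {1}->].
have pB : plactic B (key_word n r a) by apply: plactic_key_word.
have sB : sorted geq B.
  rewrite /B /block_word; have : sorted geq (rev (iota 0 n)) by rewrite rev_sorted iota_sorted.
  elim: (rev _) => //= x s IH px; have := IH (path_sorted px).
  rewrite !(sorted_pairwise (rev_trans leq_trans)) pairwise_cat => ->; rewrite andbT; apply/andP; split.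
    apply/allrelP=> y t /nseqP[-> _] /flattenP[_ /mapP[x' sx' ->] /nseqP[-> _]].
    by move: px; rewrite path_sortedE; [case/andP=> /allP/(_ _ sx') | exact: rev_trans leq_trans].
  by elim: (a x) => //= m ->; rewrite andbT all_nseq /= leqnn orbT.
have C : row_compatible n (key_word n r a) (map dg B).
  split; last by rewrite un2.
    rewrite sorted_map; apply: sub_sorted sB => x y /= le_yx.
    by rewrite /by_row /dg /=; lia.
  apply/allP=> _ /mapP[x Bx ->]; rewrite /flagged /= leqnn /=.
  by case/flattenP: Bx => _ /mapP[y + ->] /nseqP[-> _]; rewrite mem_rev mem_iota.
exists [:: map dg B]; split=> //; last by rewrite big_seq1 un1.
move=> z; rewrite inE; split=> [/eqP->//|Cz]; apply/eqP.
have dz := diagonal_biword (fun x lt_xn => closes_key_word r lt_xn (asc x lt_xn)) Cz.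
apply: (sorted_eq by_row_trans by_row_anti); [by case: Cz|by case: C|].
rewrite (dg_id _ dz); apply: perm_map; apply: plactic_perm.
by case: Cz => _ _ /plactic_trans; apply; apply: plactic_sym.
Qed.

Lemma compatible_sum_exists r a : exists f, is_compatible_sum (n := n) (key_word n r a) f.
Proof.
have lt_K : all (gtn n) (key_word n r a).
  apply/allP=> x /flattenP[_ /mapP[k _ ->]].
  by rewrite /key_column mem_rev mem_filter mem_iota => /andP[_].
have [k kE] := vals_tuple lt_K; rewrite -kE; eexists; exact: compatible_sum_words.
Qed.

Lemma eq_key_word r a b : (forall x, x < n -> a x = b x) -> key_word n r a = key_word n r b.
Proof.
move=> ab; congr flatten; apply: eq_map => k; congr rev; apply: eq_in_filter => x.
by rewrite mem_iota => /ab->.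
Qed.

End Base.

(** * Shortest sorting words *)

Section Inversions.
Variable n : nat.
Implicit Types (b c : n.-tuple nat) (i : 'I_n.-1) (s : seq 'I_n.-1).

Definition act i b : n.-tuple nat := [tuple tnth b (simple_tr i k) | k < n].

Definition ascents b : {set 'I_n * 'I_n} :=
  [set xy : 'I_n * 'I_n | (xy.1 < xy.2) && (tnth b xy.1 < tnth b xy.2)].

Lemma actK i : involutive (act i).
Proof. by move=> b; apply: eq_from_tnth => k; rewrite !tnth_mktuple tpermK. Qed.

Lemma card_ascents_act_le i b :
  #|ascents b :\ (this_pos i, next_pos i)| <= #|ascents (act i b) :\ (this_pos i, next_pos i)|.
Proof.
pose f (xy : 'I_n * 'I_n) := (simple_tr i xy.1, simple_tr i xy.2).
have inj_f : injective f.
  by move=> [x y] [x' y'] [/perm_inj-> /perm_inj->].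
rewrite -(card_imset _ inj_f); apply/subset_leq_card/subsetP=> _ /imsetP[[x y] + ->].
rewrite !inE !tnth_mktuple /= /simple_tr !tpermK => /and3P[ne lt_xy ->]; rewrite andbT.
move: ne lt_xy; rewrite /f !xpair_eqE /=.
case: tpermP => [->|->|/eqP + /eqP +]; case: tpermP => [->|->|/eqP + /eqP +];
  rewrite -!val_eqE /=; lia.
Qed.

Lemma card_ascents_act i b :
  #|ascents b| + (tnth b (next_pos i) < tnth b (this_pos i)) =
  #|ascents (act i b)| + (tnth b (this_pos i) < tnth b (next_pos i)).
Proof.
rewrite (cardsD1 (this_pos i, next_pos i)) [#|ascents (act i b)|](cardsD1 (this_pos i, next_pos i)).
rewrite !inE /= ltnSn !tnth_mktuple /simple_tr tpermL tpermR /=.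
have -> : #|ascents b :\ (this_pos i, next_pos i)| = #|ascents (act i b) :\ (this_pos i, next_pos i)|.
  by apply/eqP; rewrite eqn_leq card_ascents_act_le -{2}(actK i b) card_ascents_act_le.
by rewrite addnC addnA [RHS]addnAC -!addnA.
Qed.

Lemma perm_sends_cons i s b c :
  perm_sends (perm_of_word (i :: s)) b c = perm_sends (perm_of_word s) (act i b) c.
Proof. by apply: eq_forallb => k; rewrite /= permM tnth_mktuple. Qed.

Lemma perm_sends_nil b c : perm_sends (perm_of_word [::]) b c = (b == c).
Proof.
apply/forallP/eqP => [E|-> k]; last by rewrite perm1.
by apply: eq_from_tnth => k; have /eqP := E k; rewrite perm1.
Qed.

Lemma sorted_tnth c (x y : 'I_n) : sorted geq c -> x <= y -> tnth c y <= tnth c x.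
Proof.
move=> sc le_xy; rewrite !(tnth_nth 0).
have := sorted_leq_nth (rev_trans leq_trans) leqnn 0 sc; apply => //; by rewrite inE size_tuple.
Qed.

Lemma ascents_sorted c : sorted geq c -> ascents c = set0.
Proof.
move=> sc; apply/setP=> -[x y]; rewrite !inE /=; apply/negP=> /andP[lt_xy].
by rewrite ltnNge sorted_tnth // ltnW.
Qed.

Lemma card_ascents_le s b c : sorted geq c -> perm_sends (perm_of_word s) b c ->
  #|ascents b| <= size s.
Proof.
move=> sc; elim: s b => [|i s IH] b; first by rewrite perm_sends_nil => /eqP->; rewrite ascents_sorted ?cards0.
rewrite perm_sends_cons => /IH le_s.
apply: (@leq_trans (#|ascents b| + (tnth b (next_pos i) < tnth b (this_pos i)))).
  exact: leq_addr.
rewrite card_ascents_act -[size _]addn1.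
by apply: leq_add le_s _; case: (_ < _).
Qed.

Lemma sort_act i b : sort_comp (act i b) = sort_comp b.
Proof.
apply: val_inj; apply/perm_sortP; [by move=> x y; rewrite leq_total | exact: rev_trans leq_trans
  | by move=> x y; rewrite andbC => /anti_leq | ].
by apply/tuple_permP; exists (simple_tr i); congr val; apply: eq_from_tnth => k; rewrite !tnth_mktuple.
Qed.

Lemma sort_comp_sorted b : sorted geq (sort_comp b).
Proof. by apply: sort_sorted => x y; rewrite leq_total. Qed.

Lemma sorting_word b : exists2 s,
  perm_sends (perm_of_word s) b (sort_comp b) & size s = #|ascents b|.
Proof.
have [m] := ubnP #|ascents b|; elim: m b => // m IH b lt_m.
have [i lt_i|no_asc] := pickP (fun i => tnth b (this_pos i) < tnth b (next_pos i)).
  have := card_ascents_act i b; rewrite lt_i ltnNge (ltnW lt_i) addn0 addn1 => E.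
  have [|s sb sz] := IH (act i b); first by rewrite E in lt_m.
  exists (i :: s); first by rewrite perm_sends_cons -(sort_act i).
  by rewrite /= sz.
have sb : sorted geq b.
  apply/(sortedP 0) => k; rewrite size_tuple => lt_kn.
  have lt_k : k < n.-1 by rewrite ltn_predRL.
  have := no_asc (Ordinal lt_k); rewrite !(tnth_nth 0) /= => /negbT; rewrite -leqNgt.
  by [].
exists [::]; last by rewrite ascents_sorted ?cards0.
rewrite perm_sends_nil; apply/eqP/val_inj; rewrite /= sorted_sort //.
exact: rev_trans leq_trans.
Qed.

Definition rev_fun b x := nth 0 (rev b) x.

Lemma rev_fun_act i b x : x < n ->
  rev_fun (act i b) x = rev_fun b (swap (n.-2 - i) x).
Proof.
move=> lt_xn; have lt_i := ltn_ord i; pose y := Ordinal lt_xn.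
have rE c z : z < n -> rev_fun c z = nth 0 c (n - z.+1).
  by move=> lt_zn; rewrite /rev_fun nth_rev size_tuple.
rewrite !rE //; last first.
  by rewrite /swap; case: eqP => [_|_]; [lia | case: eqP => _; lia].
have -> : n - x.+1 = rev_ord y by [].
rewrite -tnth_nth tnth_mktuple (tnth_nth 0); congr nth.
rewrite /simple_tr /swap; case: tpermP => [/(congr1 val)|/(congr1 val)|/eqP + /eqP +]; rewrite -?val_eqE /=.
- by move=> E; case: eqP; [lia|]; case: eqP; lia.
- by move=> E; case: eqP; lia.
by move=> n1 n2; case: eqP; [lia|]; case: eqP; lia.
Qed.

Lemma rev_fun_next i b : rev_fun b (n.-2 - i) = tnth b (next_pos i).
Proof.
have lt_i := ltn_ord i; rewrite /rev_fun nth_rev size_tuple; last by lia.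
by rewrite (tnth_nth 0) /=; congr nth; lia.
Qed.

Lemma rev_fun_this i b : rev_fun b (n.-2 - i).+1 = tnth b (this_pos i).
Proof.
have lt_i := ltn_ord i; rewrite /rev_fun nth_rev size_tuple; last by lia.
by rewrite (tnth_nth 0) /=; congr nth; lia.
Qed.

Lemma xpow_weight b : xpow b = weight n (block_word (rev_fun b) (rev (iota 0 n))).
Proof.
congr 'X_[_]; apply/mnmP=> k; rewrite mnmE count_block_word ?ltn_ord //.
have -> : Multinom b k = tnth b k by rewrite multinomE.
rewrite /rev_fun nth_rev size_tuple ?ltn_ord // (tnth_nth 0).
by congr nth; have := ltn_ord k; rewrite /=; lia.
Qed.

Lemma compatible_sum_word r s b c : sorted geq c -> perm_sends (perm_of_word s) b c ->
  size s = #|ascents b| -> (forall x, rev_fun b x <= r) ->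
  is_compatible_sum (key_word n r (rev_fun b)) (foldr (@demazure n) (xpow c) s).
Proof.
move=> sc; elim: s b => [|i s IH] b.
  rewrite perm_sends_nil => /eqP-> _ le_r /=; rewrite xpow_weight.
  apply: compatible_sum_base => // x lt_xn; rewrite /rev_fun.
  have sc' : sorted leq (rev c) by rewrite rev_sorted.
  by apply: (sorted_leq_nth leq_trans leqnn 0 sc') => //; rewrite inE size_rev size_tuple // ltnW.
rewrite perm_sends_cons => sb sz le_r; have le_s := card_ascents_le sc sb.
have E := card_ascents_act i b; rewrite -sz /= in E.
have lt_i : tnth b (this_pos i) < tnth b (next_pos i).
  rewrite ltnNge; apply/negP=> le_i; move: E; rewrite [X in _ = _ + X](_ : _ = 0); last first.
    by apply/eqP; rewrite eqb0 -leqNgt.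
  by move=> E; move: le_s; rewrite -[#|_|]addn0 -E addSn ltnNge leq_addr.
have szs : size s = #|ascents (act i b)|.
  by move: E; rewrite lt_i ltnNge (ltnW lt_i) addn0 addn1 => -[].
have [f fP] := compatible_sum_exists n r (rev_fun b).
have le_r' x : rev_fun (act i b) x <= r.
  have [lt_xn|le_nx] := ltnP x n; first by rewrite rev_fun_act.
  by rewrite /rev_fun nth_default // size_rev size_tuple.
rewrite /= -(is_compatible_sum_demazure _ fP _) //.
  by rewrite rev_fun_this rev_fun_next ltnW.
rewrite -(eq_key_word r (a := rev_fun (act i b))); first exact: IH.
by move=> x lt_xn; rewrite rev_fun_act.
Qed.

Lemma key_poly_compatible_sum r b : (forall x, rev_fun b x <= r) ->
  is_compatible_sum (key_word n r (rev_fun b)) (key_poly b).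
Proof.
rewrite /key_poly /demazure_perm /min_sorting_perm.
case: (xchooseP (min_sorting_perm_subproof b)); set w := xchoose _.
case/andP=> sw /forallP min_w le_r.
case/andP: (xchooseP (reduced_word_subproof w)) => /eqP wE /eqP sz.
have [s sb szs] := sorting_word b.
apply: compatible_sum_word => //; first exact: sort_comp_sorted; first by rewrite wE.
apply/eqP; rewrite eqn_leq; apply/andP; split; last first.
  by apply: (card_ascents_le (sort_comp_sorted b)); rewrite wE.
rewrite -szs sz; have /implyP/(_ sb) := min_w (perm_of_word s).
move/leq_trans; apply; rewrite /perm_length; case: ex_minnP => m _; apply.
by apply/existsP; exists (in_tuple s).
Qed.

End Inversions.

Section KeyWord.
Variable n : nat.
Implicit Types (C : seq 'I_n) (T : seq (seq 'I_n)).

Lemma key_mem_head C T (x : 'I_n) : is_key (C :: T) -> x \in flatten T -> x \in C.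
Proof.
case/andP=> _; elim: T C => //= D T IH C /andP[/allP sDC pT].
by rewrite mem_cat => /orP[/sDC|/(IH _ pT)/sDC].
Qed.

Lemma mem_key_column T k (x : 'I_n) : is_key T ->
  (x \in nth [::] T k) = (k < count_mem x (flatten T)).
Proof.
elim: T k => [|C T IH] k kT; first by rewrite nth_nil.
have uC : uniq C.
  case/andP: kT => /andP[/= /andP[/andP[_ sC] _] _] _.
  by apply: sorted_uniq sC => [y z t|y]; [apply: ltn_trans | apply: ltnn].
have kT' : is_key T.
  case/andP: kT => /andP[/= /andP[_ cT] /path_sorted sT] /path_sorted nT.
  by rewrite /is_key /semistandard cT sT nT.
rewrite /= count_cat (count_uniq_mem _ uC).
have [xC|nxC] := boolP (x \in C); first by case: k => [|k] //=; rewrite IH.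
rewrite (_ : count_mem x (flatten T) = 0); last first.
  by apply/count_memPn; apply: contra nxC; apply: key_mem_head kT.
case: k => [|k] /=; first by rewrite (negPf nxC).
by rewrite IH // (_ : count_mem x (flatten T) = 0) //; apply/count_memPn; apply: contra nxC; apply: key_mem_head kT.
Qed.

Lemma vals_key (a : n.-tuple nat) : exists r, (forall x, nth 0 a x <= r) /\
  vals (col_word (key a)) = key_word n r (fun x => nth 0 a x).
Proof.
rewrite /key; case/andP: (xchooseP (key_subproof a)); set T := xchoose _.
move=> kT /forallP wT; have memT k (x : 'I_n) : (x \in nth [::] T k) = (k < nth 0 a x).
  by rewrite mem_key_column // (eqP (wT x)) (tnth_nth 0).
exists (size T); split=> [x|].
  have [lt_xn|le_nx] := ltnP x n; last by rewrite nth_default ?size_tuple.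
  by rewrite leqNgt -(memT _ (Ordinal lt_xn)) nth_default.
rewrite /vals /col_word map_flatten -map_comp -{1}(mkseq_nth [::] T) /mkseq -map_comp.
congr flatten; apply/eq_in_map => k; rewrite mem_iota add0n => /= lt_kT.
rewrite map_rev; congr rev.
apply: (irr_sorted_eq ltn_trans ltnn).
- rewrite sorted_map; case/andP: kT => /andP[/allP cT _] _.
  by case/andP: (cT _ (mem_nth [::] lt_kT)).
- by apply: sorted_filter; [apply: ltn_trans | apply: iota_ltn_sorted].
move=> x; rewrite mem_filter mem_iota /= add0n; apply/mapP/andP => [[y yT ->]|[lt_x lt_xn]].
  by rewrite -memT.
by exists (Ordinal lt_xn); rewrite ?memT.
Qed.

Lemma weight_rev u : weight n u \mPo [tuple 'X_(rev_ord i) | i < n] =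
  'X_[[multinom count_mem (val k) u | k < n]].
Proof.
rewrite comp_mpolyX mpolyXE_id (reindex_inj rev_ord_inj) /=; apply: eq_bigr => k _.
by rewrite tnth_mktuple !mnmE rev_ordK.
Qed.

End KeyWord.

Theorem mainTheorem2 (n : nat) (a : n.-tuple nat) :
  let p := size (col_word (key a)) in
  young_key_poly a =
  (\sum_(c : p.-tuple 'I_n | knuth (flip_word c) (in_tuple (col_word (key a))))
     \sum_(w : p.-tuple 'I_n | compatible c w) xpow (word_comp (flip_word w)))%R.
Proof.
move=> p; have [r [le_ar keyE]] := vals_key a.
have rev_a x : rev_fun (rev_comp a) x = nth 0 a x by rewrite /rev_fun /= revK.
have key_sum := key_poly_compatible_sum (b := rev_comp a) (r := r).
have {}key_sum : is_compatible_sum (vals (in_tuple (col_word (key a)))) (key_poly (rev_comp a)).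
  rewrite keyE -(eq_key_word r (a := rev_fun (rev_comp a))); last by move=> x _.
  by apply: key_sum => x; rewrite rev_a.
rewrite /young_key_poly (compatible_sum_unique key_sum (compatible_sum_words _)).
rewrite rmorph_sum; apply: eq_bigr => c _; rewrite rmorph_sum; apply: eq_bigr => w _ /=.
rewrite weight_rev; congr 'X_[_]; apply/mnmP=> k; rewrite mnmE multinomE tnth_mktuple.
by rewrite count_map; apply: eq_count => x /=; rewrite val_eqE.
Qed.
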